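(* Let $G$ be a simply connected nilpotent Lie group with a left-invariant complex structure $J$, $\dim_{\mathbb R}G=2n$, let $\Gamma\subset G$ be a lattice, and let $G_{\mathbb C}$ be the simply connected complex nilpotent group with Lie algebra $\mathfrak g_{\mathbb C}$, acting algebraically on $\mathbb C^n$ by the extension of the deck action $\rho$ of $G$. Then $\mathbb C[w]=\mathbb C[w_1,\dots,w_n]$ and $\Omega^p_{\mathrm{pol}}$ are locally finite, locally unipotent rational $G_{\mathbb C}$-modules. Each is the directed union of the finite-dimensional $G_{\mathbb C}$-submodules $W_m$, respectively $W_m^{(p)}$ ($m\ge0$), and on each of these $G_{\mathbb C}$ acts by a unipotent algebraic representation, with a $G_{\mathbb C}$-stable complete flag whose one-dimensional subquotients are trivial. In particular, $G$ and $\Gamma$ act by unipotent operators.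
   Context: Let $\mathfrak g$ be the Lie algebra of $G$, $\mathfrak g_{\mathbb C}=\mathfrak g\otimes\mathbb C$. Fix a biholomorphism $\Phi\colon(G,J)\to\mathbb C^n$ which, in exponential coordinates on $G$ (precomposed with $\exp\colon\mathfrak g\to G$), is polynomial with polynomial inverse (existence is a known theorem of Hasegawa--Rollenske--Sillari--Tomassini--Wehler). Put $\rho(g)=\Phi\circ L_g\circ\Phi^{-1}$, where $L_g$ is left translation; each $\rho(g)$ is a polynomial automorphism of $\mathbb C^n$, and $\rho(\exp\xi)(w)$ is given by a polynomial map $F(\xi,w)$ with complex coefficients; extending $F$ to $\xi\in\mathfrak g_{\mathbb C}$ gives an algebraic left action of $G_{\mathbb C}=\exp\mathfrak g_{\mathbb C}$ (a unipotent algebraic group) on $\mathbb C^n$ extending $\rho$, also denoted $\rho$. $\Omega^p_{\mathrm{pol}}$ is the space of holomorphic $p$-forms $\sum_{|I|=p}f_I\,dw^I$ on $\mathbb C^n$ with $f_I\in\mathbb C[w]$. $G_{\mathbb C}$ acts on $\mathbb C[w]$ and on $\Omega^p_{\mathrm{pol}}$ by $x\cdot\omega=\rho(x^{-1})^*\omega$. $W_m\subseteq\mathbb C[w]$ is the linear span of all $x\cdot f$ with $x\in G_{\mathbb C}$ and $f\in\mathbb C[w]$ of total degree $\le m$; $W_m^{(p)}\subseteq\Omega^p_{\mathrm{pol}}$ is the linear span of all $x\cdot\omega$ with $x\in G_{\mathbb C}$ and $\omega=\sum_If_I\,dw^I$, $\deg f_I\le m$. For a linear algebraic group $H$ over $\mathbb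 C$, a rational $H$-module is a $\mathbb C$-vector space with linear $H$-action that is the union of its finite-dimensional $H$-stable subspaces $V'$, on each of which $H$ acts through a morphism of algebraic groups $H\to\mathrm{GL}(V')$. It is locally unipotent if each such action on $V'$ admits an $H$-stable complete flag with trivial one-dimensional subquotients. *)

(* Defs.v *)
From HB Require Import structures.
From mathcomp Require Import all_boot all_order all_algebra.
From mathcomp Require Import complex.
From mathcomp Require Import mpoly.
From mathcomp Require Import boolp classical_sets functions reals.
From mathcomp Require Import topology normedtype derive.
Set Implicit Arguments.
Unset Strict Implicit.
Unset Printing Implicit Defensive.
Import Order.TTheory GRing.Theory Num.Theory numFieldNormedType.Exports.
Local Open Scope ring_scope.

Definition lspan (K : fieldType) (V : lmodType K) (S : V -> Prop) : V -> Prop :=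
  fun v => exists (k : nat) (c : 'I_k -> K) (u : 'I_k -> V),
    (forall i, S (u i)) /\ v = \sum_(i < k) c i *: u i.

Definition is_basis (K : fieldType) (V : lmodType K) (k : nat)
    (e : 'I_k -> V) (U : V -> Prop) : Prop :=
  (forall v, U v <-> exists c : 'I_k -> K, v = \sum_(i < k) c i *: e i) /\
  (forall c : 'I_k -> K, \sum_(i < k) c i *: e i = 0 -> forall i, c i = 0).

(* [U] is a linear subspace of dimension [k]. *)
Definition has_dim (K : fieldType) (V : lmodType K) (U : V -> Prop) (k : nat) :
  Prop := exists e : 'I_k -> V, is_basis e U.

Definition finite_dim (K : fieldType) (V : lmodType K) (U : V -> Prop) : Prop :=
  exists k, has_dim U k.

Definition unipotent_on (K : fieldType) (V : lmodType K) (T : V -> V)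
    (U : V -> Prop) : Prop :=
  (forall u, U u -> U (T u)) /\
  exists N : nat, forall u, U u -> iter N (fun v => T v - v) u = 0.

(* An affine algebraic group over K is given by its abstract group [H] of
   K-points together with the predicate [reg] selecting, among all functions
   H -> K, those of the coordinate ring K[H]. *)

Definition linear_action (K : fieldType) (V : lmodType K) (H : groupType)
    (act : H -> V -> V) : Prop :=
  [/\ forall x (a : K) u v, act x (a *: u + v) = a *: act x u + act x v,
      forall v, act 1%g v = v &
      forall x y v, act (x * y)%g v = act x (act y v)].

Definition stable (K : fieldType) (V : lmodType K) (H : groupType)
    (act : H -> V -> V) (U : V -> Prop) : Prop :=
  forall x v, U v -> U (act x v).

Definition locally_finite (K : fieldType) (V : lmodType K) (H : groupType)
    (act : H -> V -> V) : Prop :=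
  forall v, exists U, [/\ finite_dim U, stable act U & U v].

(* H acts on the stable finite-dimensional [U] through a morphism of algebraic
   groups H -> GL(U): in any basis of U the matrices form a group morphism, and
   the generators of K[GL_k], i.e. the entries and 1/det, pull back to regular
   functions on H. *)
Definition algebraic_on (K : fieldType) (V : lmodType K) (H : groupType)
    (reg : (H -> K) -> Prop) (act : H -> V -> V) (U : V -> Prop) : Prop :=
  forall (k : nat) (e : 'I_k -> V), is_basis e U ->
  exists M : H -> 'M[K]_k,
    (forall x j, act x (e j) = \sum_(i < k) M x i j *: e i) /\
    (forall x, M x \in unitmx) /\
    (forall x y, M (x * y)%g = M x *m M y) /\
    (forall i j, reg (fun x => M x i j)) /\
    reg (fun x => (\det (M x))^-1).

Definition rational_module (K : fieldType) (V : lmodType K) (H : groupType)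
    (reg : (H -> K) -> Prop) (act : H -> V -> V) : Prop :=
  [/\ linear_action act,
      locally_finite act &
      forall U, finite_dim U -> stable act U -> algebraic_on reg act U].

(* [Fl] is a complete flag 0 = Fl 0 < Fl 1 < ... < Fl k = U of stable subspaces
   such that H acts trivially on every Fl (i+1) / Fl i. *)
Definition has_trivial_flag (K : fieldType) (V : lmodType K) (H : groupType)
    (act : H -> V -> V) (U : V -> Prop) : Prop :=
  exists (k : nat) (Fl : nat -> V -> Prop),
    (forall v, Fl k v <-> U v) /\
    (forall i, (i <= k)%N -> has_dim (Fl i) i /\ stable act (Fl i)) /\
    (forall i, (i < k)%N ->
       (forall v, Fl i v -> Fl i.+1 v) /\
       (forall x v, Fl i.+1 v -> Fl i (act x v - v))).

Definition locally_unipotent (K : fieldType) (V : lmodType K) (H : groupType)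
    (act : H -> V -> V) : Prop :=
  forall U, finite_dim U -> stable act U -> has_trivial_flag act U.

Definition orbit_span (K : fieldType) (V : lmodType K) (H : groupType)
    (act : H -> V -> V) (D : V -> Prop) : V -> Prop :=
  lspan (fun v => exists x u, D u /\ v = act x u).

Definition directed_union (V : Type) (W : nat -> V -> Prop) : Prop :=
  (forall m1 m2, (m1 <= m2)%N -> forall v, W m1 v -> W m2 v) /\
  (forall v, exists m, W m v).

Definition unipotent_rep (K : fieldType) (V : lmodType K) (H : groupType)
    (reg : (H -> K) -> Prop) (act : H -> V -> V) (U : V -> Prop) : Prop :=
  algebraic_on reg act U /\ forall x, unipotent_on (act x) U.

Definition is_lie_bracket (K : fieldType) (d : nat)
    (br : 'rV[K]_d -> 'rV[K]_d -> 'rV[K]_d) : Prop :=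
  [/\ forall (a : K) x y z, br (a *: x + y) z = a *: br x z + br y z,
      forall (a : K) x y z, br x (a *: y + z) = a *: br x y + br x z,
      forall x, br x x = 0 &
      forall x y z, br x (br y z) + br y (br z x) + br z (br x y) = 0].

(* [lower_central br k] is the term g^(k+1), where g^1 = g. *)
Fixpoint lower_central (K : fieldType) (d : nat)
    (br : 'rV[K]_d -> 'rV[K]_d -> 'rV[K]_d) (k : nat) : 'rV[K]_d -> Prop :=
  if k is k'.+1 then
    lspan (fun z => exists x y, lower_central br k' y /\ z = br x y)
  else fun _ => True.

Definition nilpotent_bracket (K : fieldType) (d : nat)
    (br : 'rV[K]_d -> 'rV[K]_d -> 'rV[K]_d) : Prop :=
  exists c, forall z, lower_central br c z -> z = 0.

(* [z1,[z2,...[z(m-1),zm]...]] *)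
Fixpoint nested_bracket (K : fieldType) (d : nat)
    (br : 'rV[K]_d -> 'rV[K]_d -> 'rV[K]_d) (s : seq 'rV[K]_d) : 'rV[K]_d :=
  match s with
  | [::] => 0
  | [:: z] => z
  | z :: s' => br z (nested_bracket br s')
  end.

(* x^{r1} y^{s1} ... x^{rk} y^{sk}, as a word *)
Definition dynkin_word (K : fieldType) (d : nat) (x y : 'rV[K]_d)
    (t : seq ('I_d.+1 * 'I_d.+1)) : seq 'rV[K]_d :=
  flatten [seq nseq q.1 x ++ nseq q.2 y | q : 'I_d.+1 * 'I_d.+1 <- t].

(* Dynkin's form of the Baker-Campbell-Hausdorff series:
     sum_k (-1)^(k-1)/k sum_{r_i + s_i > 0}
       [x^{r1} y^{s1} ... x^{rk} y^{sk}] / (sum_i (r_i + s_i) prod_i r_i! s_i!).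
   A nilpotent Lie algebra of dimension d has g^(d+1) = 0, so the series is cut
   at total degree d without losing any term. *)
Definition bch (K : numFieldType) (d : nat)
    (br : 'rV[K]_d -> 'rV[K]_d -> 'rV[K]_d) (x y : 'rV[K]_d) : 'rV[K]_d :=
  \sum_(1 <= k < d.+1)
    \sum_(t : k.-tuple ('I_d.+1 * 'I_d.+1) |
            all (fun q : 'I_d.+1 * 'I_d.+1 => 0 < q.1 + q.2)%N t &&
            (size (dynkin_word x y t) <= d)%N)
      ((-1) ^+ k.-1 /
        (k * size (dynkin_word x y t) * \prod_(q <- t) (q.1`! * q.2`!))%:R)
      *: nested_bracket br (dynkin_word x y t).

(* The simply connected nilpotent Lie group over K (= R or C) with nilpotent Lie
   algebra (K^d, bracket): exp is a global chart, in which the product is the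
   Baker-Campbell-Hausdorff product. The manifold structure (and, over C, the
   structure of algebraic variety) is the one transported by exp. *)
Record sc_nilpotent_group (K : numFieldType) (d : nat) := ScNilpotentGroup {
  bracket : 'rV[K]_d -> 'rV[K]_d -> 'rV[K]_d;
  bracket_lie : is_lie_bracket bracket;
  bracket_nilpotent : nilpotent_bracket bracket;
  group_of :> groupType;
  exp : 'rV[K]_d -> group_of;
  log : group_of -> 'rV[K]_d;
  expK : cancel exp log;
  logK : cancel log exp;
  expM : forall x y, (exp x * exp y)%g = exp (bch bracket x y)
}.

Definition regular_function (K : numFieldType) (d : nat)
    (H : sc_nilpotent_group K d) (phi : H -> K) : Prop :=
  exists P : {mpoly K[d]}, forall x, phi x = P.@[fun i => log x 0 i].

Definition to_C (R : realType) (d : nat) (v : 'rV[R]_d) : 'rV[R[i]]_d :=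
  map_mx (@real_complex R) v.

(* The Lie algebra of GC is g_C: its C-bilinear bracket restricts to that of g
   on R^d, which determines it. *)
Definition is_complexification (R : realType) (d : nat)
    (G : sc_nilpotent_group R d) (GC : sc_nilpotent_group R[i] d) : Prop :=
  forall x y, bracket GC (to_C x) (to_C y) = to_C (bracket G x y).

(* Integrable almost complex structure on the Lie algebra; vectors are rows, so
   J is applied as [v *m J]. *)
Definition left_invariant_complex_structure (R : realType) (d : nat)
    (G : sc_nilpotent_group R d) (J : 'M[R]_d) : Prop :=
  J *m J = - 1%:M /\
  forall x y, bracket G (x *m J) (y *m J) - bracket G x y
    - bracket G (x *m J) y *m J - bracket G x (y *m J) *m J = 0.

(* Discrete subgroup with compact quotient Gamma\G. *)
Definition is_lattice (R : realType) (d : nat) (G : sc_nilpotent_group R d)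
    (Gamma : set G) : Prop :=
  [/\ Gamma 1%g,
      forall x y, Gamma x -> Gamma y -> Gamma (x * y^-1)%g,
      forall x, Gamma x -> \forall v \near log x, Gamma (exp G v) -> exp G v = x &
      exists2 A : set 'rV[R]_d, compact A &
        forall g, exists x v, [/\ Gamma x, A v & g = (x * exp G v)%g]].

Definition polymap (K : comNzRingType) (k m : nat) (P : m.-tuple {mpoly K[k]})
    (v : 'rV[K]_k) : 'rV[K]_m :=
  \row_(j < m) (tnth P j).@[fun i => v 0 i].

(* C^n as the real vector space R^(n+n). *)
Definition re_im (R : realType) (n : nat) (w : 'rV[R[i]]_n) : 'rV[R]_(n + n) :=
  row_mx (map_mx (@complex.Re R) w) (map_mx (@complex.Im R) w).

Definition cderive0 (R : realType) (c : R -> R[i]) : R[i] :=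
  Complex (derive1 (fun t => complex.Re (c t)) 0)
          (derive1 (fun t => complex.Im (c t)) 0).

(* The tangent vector at g of the left-invariant field v is the velocity of
   t |-> g exp(tv); the condition is d Phi (J v) = i d Phi (v). *)
Definition holomorphic (R : realType) (d n : nat) (G : sc_nilpotent_group R d)
    (J : 'M[R]_d) (Phi : G -> 'rV[R[i]]_n) : Prop :=
  forall (g : G) (v : 'rV[R]_d) (j : 'I_n),
    cderive0 (fun t : R => Phi (g * exp G (t *: (v *m J)))%g 0 j) =
    'i%C * cderive0 (fun t : R => Phi (g * exp G (t *: v))%g 0 j).

(* Phi : (G,J) -> C^n with inverse Psi, both polynomial as maps of real vector
   spaces in exponential coordinates (the components of Phi are complex-valued
   polynomials of the real coordinates, those of Psi real polynomials of Re w and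
   Im w). In particular both are smooth, so the derivatives in [holomorphic]
   exist, and Psi is holomorphic as the inverse of a holomorphic diffeomorphism. *)
Definition polynomial_biholomorphism (R : realType) (d n : nat)
    (G : sc_nilpotent_group R d) (J : 'M[R]_d)
    (Phi : G -> 'rV[R[i]]_n) (Psi : 'rV[R[i]]_n -> G) : Prop :=
  cancel Phi Psi /\ cancel Psi Phi /\ holomorphic J Phi /\
  (exists P : n.-tuple {mpoly R[i][d]},
     forall xi, Phi (exp G xi) = polymap P (to_C xi)) /\
  (exists Q : d.-tuple {mpoly R[n + n]},
     forall w, log (Psi w) = polymap Q (re_im w)).

Definition deck (R : realType) (d n : nat) (G : sc_nilpotent_group R d)
    (Phi : G -> 'rV[R[i]]_n) (Psi : 'rV[R[i]]_n -> G) (g : G)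
    (w : 'rV[R[i]]_n) : 'rV[R[i]]_n :=
  Phi (g * Psi w)%g.

(* F(xi, w) represents the deck action: rho(exp xi)(w) = F(xi, w). This
   determines F. *)
Definition represents_deck (R : realType) (d n : nat)
    (G : sc_nilpotent_group R d) (Phi : G -> 'rV[R[i]]_n)
    (Psi : 'rV[R[i]]_n -> G) (F : n.-tuple {mpoly R[i][d + n]}) : Prop :=
  forall (xi : 'rV[R]_d) (w : 'rV[R[i]]_n),
    deck Phi Psi (exp G xi) w = polymap F (row_mx (to_C xi) w).

(* The polynomial self-map w |-> F(zeta, w) of K^n. *)
Definition specialize (K : comNzRingType) (d n : nat)
    (F : n.-tuple {mpoly K[d + n]}) (zeta : 'rV[K]_d) : n.-tuple {mpoly K[n]} :=
  [tuple tnth F j \mPo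
     [tuple match fintype.split k with
            | inl i => (zeta 0 i)%:MP
            | inr l => 'X_l
            end | k < d + n] | j < n].

Definition rhoC (K : numFieldType) (d n : nat) (H : sc_nilpotent_group K d)
    (F : n.-tuple {mpoly K[d + n]}) (x : H) : n.-tuple {mpoly K[n]} :=
  specialize F (log x).

Notation multi_index n p :=
  {t : p.-tuple 'I_n | sorted ltn [seq val i | i <- t]}.

(* The form sum_I f_I dw^I, as the family of its coefficients f_I *)
Notation poly_form K n p := {ffun multi_index n p -> {mpoly K[n]}}.

Definition pullback_fun (K : comNzRingType) (n : nat)
    (phi : n.-tuple {mpoly K[n]}) (f : {mpoly K[n]}) : {mpoly K[n]} :=
  f \mPo phi.

(* phi^*(f dw^I) = sum_L (f o phi) det(d phi_{i_a} / d w_{l_b})_{a,b} dw^L *)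
Definition pullback_form (K : comNzRingType) (n p : nat)
    (phi : n.-tuple {mpoly K[n]}) (omega : poly_form K n p) : poly_form K n p :=
  [ffun L : multi_index n p => \sum_(I : multi_index n p)
     (omega I \mPo phi) *
     \det (\matrix_(a < p, b < p)
             mderiv (tnth (val L) b) (tnth phi (tnth (val I) a)))].

Definition fun_action (K : numFieldType) (d n : nat)
    (H : sc_nilpotent_group K d) (F : n.-tuple {mpoly K[d + n]}) (x : H)
    (f : {mpoly K[n]}) : {mpoly K[n]} :=
  pullback_fun (rhoC F (x^-1)%g) f.

Definition form_action (K : numFieldType) (d n p : nat)
    (H : sc_nilpotent_group K d) (F : n.-tuple {mpoly K[d + n]}) (x : H)
    (omega : poly_form K n p) : poly_form K n p :=
  pullback_form (rhoC F (x^-1)%g) omega.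

(* [msize f] is 1 + deg f, and 0 for f = 0. *)
Definition W_fun (K : numFieldType) (d n : nat) (H : sc_nilpotent_group K d)
    (F : n.-tuple {mpoly K[d + n]}) (m : nat) : {mpoly K[n]} -> Prop :=
  orbit_span (fun_action F (H := H)) (fun f => (msize f <= m.+1)%N).

Definition W_form (K : numFieldType) (d n p : nat) (H : sc_nilpotent_group K d)
    (F : n.-tuple {mpoly K[d + n]}) (m : nat) : poly_form K n p -> Prop :=
  orbit_span (form_action (p := p) F (H := H))
    (fun omega => forall I, (msize (omega I) <= m.+1)%N).

(* Main.v *)
Require Import Defs.
From HB Require Import structures.
From mathcomp Require Import all_boot all_order all_algebra.
From mathcomp Require Import perm.
From mathcomp Require Import complex.
From mathcomp Require Import mpoly.
From mathcomp Require Import boolp classical_sets functions reals.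
From mathcomp Require Import topology normedtype derive.
Set Implicit Arguments.
Unset Strict Implicit.
Unset Printing Implicit Defensive.
Import Order.TTheory GRing.Theory Num.Theory numFieldNormedType.Exports.
Local Open Scope ring_scope.

(** In exponential coordinates the group law is the Baker-Campbell-Hausdorff
    polynomial, and [F] is a polynomial map. The identities that make the deck
    transformations an action of the real group are polynomial identities holding at
    all real points, in particular at all integral ones, so they persist over the
    complex numbers ([mpoly_nat_eq0], [complexified_deck_action]) and [F] defines an
    action of the complex group. Functions and forms are then pulled back along
    polynomial maps; for forms, functoriality is the chain rule together with the
    Cauchy-Binet formula for the minors of a product of Jacobian matrices
    ([pullback_form_comp]).

    The essential property of both modules is that every orbit map is polynomial
    ([polynomial_map]): it is a finite sum of fixed vectors with polynomial functions
    of the group element as coefficients. All the conclusions hold for an arbitrary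
    linear action of a simply connected nilpotent group with this property. The span
    of the orbits of finitely many vectors is finite-dimensional, hence local
    finiteness and the finite dimension of the orbit spans of the polynomials or forms
    of bounded degree. The matrix coefficients on a stable finite-dimensional subspace
    are polynomials ([polynomial_action_algebraic]).

    For unipotence, the powers of [exp z] applied to a vector are the values at the
    natural numbers of a polynomial in one variable, and [exp z - 1] acts on them as
    the finite difference, which lowers the degree: each group element is pointwise
    unipotent ([act_pointwise_unipotent]). To pass from single elements to the whole
    group, descend along the lower central series of the Lie algebra
    ([invariant_vector_mod]). Modulo its next term the elements of a term are central,
    so in a stable subspace that is minimal among those not contained in a given stable
    [A], the vectors fixed by such an element modulo [A] again form a stable subspace,
    which unipotence keeps from being contained in [A] and which is therefore
    everything. Adjoining invariant vectors one at a time gives the flag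
    ([polynomial_action_trivial_flag]), from which the uniform unipotence of each
    element follows. *)

(** * Subspaces given by predicates *)

Definition subspace (K : fieldType) (V : lmodType K) (U : V -> Prop) : Prop :=
  U 0 /\ forall (a : K) u v, U u -> U v -> U (a *: u + v).

Section Subspaces.
Variables (K : fieldType) (V : lmodType K).
Implicit Types (U A B : V -> Prop).

Lemma subspace_scale U (a : K) u : subspace U -> U u -> U (a *: u).
Proof. by move=> [U0 UD] Uu; rewrite -[_ *: _]addr0; apply: UD. Qed.

Lemma subspace_add U u v : subspace U -> U u -> U v -> U (u + v).
Proof. by move=> [U0 UD] Uu Uv; rewrite -[u]scale1r; apply: UD. Qed.

Lemma subspace_opp U u : subspace U -> U u -> U (- u).
Proof. by move=> sU Uu; rewrite -scaleN1r; apply: subspace_scale. Qed.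

Lemma subspace_sub U u v : subspace U -> U u -> U v -> U (u - v).
Proof. by move=> sU Uu Uv; apply: subspace_add => //; apply: subspace_opp. Qed.

Lemma subspace_sum U (I : Type) (r : seq I) (P : pred I) (f : I -> V) :
  subspace U -> (forall i, P i -> U (f i)) -> U (\sum_(i <- r | P i) f i).
Proof.
move=> sU Uf; elim/big_ind: _ => //; first by case: sU.
by move=> u v; apply: subspace_add.
Qed.

Lemma subspace_lspan (S : V -> Prop) : subspace (lspan S).
Proof.
split=> [|a u v [k [c [x [Sx ->]]]] [l [d [y [Sy ->]]]]].
  by exists 0%N, (fun=> 0), (fun=> 0); split=> [[]//|]; rewrite big_ord0.
exists (k + l)%N, (fun i => match fintype.split i with inl j => a * c j | inr j => d j end),
  (fun i => match fintype.split i with inl j => x j | inr j => y j end); split.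
  by move=> i; case: fintype.split.
rewrite big_split_ord scaler_sumr; congr (_ + _); apply: eq_bigr => i _.
  by rewrite (unsplitK (inl i)) scalerA.
by rewrite (unsplitK (inr i)).
Qed.

Lemma lspan_gen (S : V -> Prop) u : S u -> lspan S u.
Proof.
move=> Su; exists 1%N, (fun=> 1), (fun=> u); split=> //.
by rewrite big_ord1 scale1r.
Qed.

Lemma lspan_sub (S U : V -> Prop) :
  subspace U -> (forall u, S u -> U u) -> forall u, lspan S u -> U u.
Proof.
move=> sU SU u [k [c [x [Sx ->]]]]; apply: subspace_sum => // i _.
by apply: subspace_scale => //; apply: SU.
Qed.

Definition span_of (k : nat) (e : 'I_k -> V) : V -> Prop :=
  fun v => exists c : 'I_k -> K, v = \sum_(i < k) c i *: e i.

Lemma subspace_span_of k (e : 'I_k -> V) : subspace (span_of e).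
Proof.
split=> [|a u v [c ->] [d ->]].
  by exists (fun=> 0); rewrite big1 // => i _; rewrite scale0r.
exists (fun i => a * c i + d i); rewrite scaler_sumr -big_split.
by apply: eq_bigr => i _; rewrite scalerDl scalerA.
Qed.

Lemma span_of_gen k (e : 'I_k -> V) i : span_of e (e i).
Proof.
exists (fun j => (j == i)%:R); rewrite (bigD1 i) //= eqxx scale1r big1 ?addr0 //.
by move=> j /negbTE ->; rewrite scale0r.
Qed.

Lemma span_of_sub k (e : 'I_k -> V) U :
  subspace U -> (forall i, U (e i)) -> forall v, span_of e v -> U v.
Proof.
by move=> sU Ue v [c ->]; apply: subspace_sum => // i _; apply: subspace_scale.
Qed.

Lemma span_of_join a b (e : 'I_a -> V) (f : 'I_b -> V) :
  exists g : 'I_(a + b) -> V, (forall v, span_of e v -> span_of g v) /\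
    (forall v, span_of f v -> span_of g v).
Proof.
exists (fun i => match fintype.split i with inl j => e j | inr j => f j end).
set g := fun i => _; have sg := subspace_span_of g; split; apply: span_of_sub => // i.
  by have := span_of_gen g (lshift b i); rewrite {2}/g (unsplitK (inl i)).
by have := span_of_gen g (rshift a i); rewrite {2}/g (unsplitK (inr i)).
Qed.

Lemma span_of_fin (I : finType) (g : I -> V) (c : I -> K) :
  span_of (fun i : 'I_#|I| => g (enum_val i)) (\sum_i c i *: g i).
Proof.
exists (fun i => c (enum_val i)).
by rewrite (reindex (@enum_val I I)) //; apply/onW_bij/enum_val_bij.
Qed.

Lemma basis_mem U k (e : 'I_k -> V) i : is_basis e U -> U (e i).
Proof. by move=> [eU _]; apply/eU/span_of_gen. Qed.

Lemma has_dim_subspace U k : has_dim U k -> subspace U.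
Proof.
move=> [e [eU _]]; have [s0 sD] := subspace_span_of e.
by split=> [|a u v /eU Uu /eU Uv]; apply/eU => //; apply: sD.
Qed.

Lemma basis_inj U k (e : 'I_k -> V) (c d : 'I_k -> K) : is_basis e U ->
  \sum_(i < k) c i *: e i = \sum_(i < k) d i *: e i -> c =1 d.
Proof.
move=> [_ fe] /eqP; rewrite -subr_eq0 -sumrB => /eqP cd i.
apply/eqP; rewrite -subr_eq0; apply/eqP.
apply: (fe (fun i => c i - d i)); rewrite -[RHS]cd.
by apply: eq_bigr => j _; rewrite scalerBl.
Qed.

Lemma has_dim_ext U U' k : (forall v, U v <-> U' v) -> has_dim U k -> has_dim U' k.
Proof.
move=> UU' [e [eU fe]]; exists e; split=> // v.
by split=> [/UU'/eU|/eU/UU'].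
Qed.

Lemma has_dim0 : has_dim (fun v : V => v = 0) 0.
Proof.
exists (fun=> 0); split=> [v|c _ []//]; split=> [->|[c ->]]; last by rewrite big_ord0.
by exists (fun=> 0); rewrite big_ord0.
Qed.

Lemma has_dim_adjoin U k u : has_dim U k -> ~ U u ->
  has_dim (fun v => exists a w, U w /\ v = a *: u + w) k.+1.
Proof.
move=> hU nUu; have sU := has_dim_subspace hU; case: hU => e [eU fe].
pose b (i : 'I_k.+1) := if unlift ord0 i is Some j then e j else u.
have b0 : b ord0 = u by rewrite /b unlift_none.
have bS i : b (lift ord0 i) = e i by rewrite /b liftK.
exists b; split=> [v|c].
  split=> [[a [w [/eU [c ->] ->]]]|[c ->]].
    exists (fun i => if unlift ord0 i is Some j then c j else a).
    rewrite big_ord_recl unlift_none b0; congr (_ + _).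
    by apply: eq_bigr => i _; rewrite liftK bS.
  exists (c ord0), (\sum_(i < k) c (lift ord0 i) *: e i); split.
    by apply/eU; exists (fun i => c (lift ord0 i)).
  by rewrite big_ord_recl b0; congr (_ + _); apply: eq_bigr => i _; rewrite bS.
rewrite big_ord_recl b0 => c0.
have Us : U (\sum_(i < k) c (lift ord0 i) *: e i).
  by apply/eU; exists (fun i => c (lift ord0 i)).
have ebs : \sum_(i < k) c (lift ord0 i) *: b (lift ord0 i) =
    \sum_(i < k) c (lift ord0 i) *: e i by apply: eq_bigr => i _; rewrite bS.
have c00 : c ord0 = 0.
  apply/eqP/negP => /negP nz; apply: nUu.
  have -> : u = - (c ord0)^-1 *: (\sum_(i < k) c (lift ord0 i) *: e i).
    move: c0 => /eqP; rewrite ebs addr_eq0 => /eqP c0.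
    by rewrite scaleNr -scalerN -c0 scalerA mulVf ?scale1r.
  exact: subspace_scale.
move=> i; case: (unliftP ord0 i) => [j|] ->; last by [].
apply: (fe (fun i => c (lift ord0 i))).
by move: c0; rewrite c00 scale0r add0r ebs.
Qed.

(** By induction on the spanning family: the last vector of the family enlarges the
    part of [U] lying in the span of the others by at most one line. *)
Lemma finite_dim_sub_span U N (e : 'I_N -> V) :
  subspace U -> (forall v, U v -> span_of e v) -> finite_dim U.
Proof.
elim: N => [|N IH] in U e *.
  move=> [U0 _] Ue; exists 0%N; apply: (has_dim_ext _ has_dim0) => v.
  by split=> [->|/Ue [c ->]] //; rewrite big_ord0.
move=> sU Ue; pose e' (i : 'I_N) := e (widen_ord (leqnSn N) i).
pose U' v := U v /\ span_of e' v.
have sS := subspace_span_of e'.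
have sU' : subspace U'.
  split; first by split; [case: sU|case: sS].
  by move=> a u v [Uu Su] [Uv Sv]; split; [case: sU|case: sS] => _; apply.
have [k hk] := IH U' e' sU' (fun v => @proj2 _ _).
have [UU'|] := pselect (forall v, U v -> U' v).
  by exists k; apply: (has_dim_ext _ hk) => v; split=> [[]//|/UU'].
move=> /existsNP [u /not_implyP [Uu nU'u]].
exists k.+1; apply: (has_dim_ext _ (has_dim_adjoin hk nU'u)) => v; split.
  by move=> [a [w [[Uw _] ->]]]; case: sU => _; apply.
have [c cE] := Ue _ Uu; rewrite big_ord_recr /= in cE.
have nzc : c ord_max != 0.
  apply/negP => /eqP c0; apply: nU'u; split=> //.
  by exists (fun i => c (widen_ord (leqnSn N) i)); rewrite cE c0 scale0r addr0.
move=> Uv; have [d dE] := Ue _ Uv; rewrite big_ord_recr /= in dE.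
exists (d ord_max / c ord_max), (v - (d ord_max / c ord_max) *: u); split.
  split; first by apply: subspace_sub => //; apply: subspace_scale.
  rewrite [X in span_of _ X](_ : _ = \sum_(i < N)
     (d (widen_ord (leqnSn N) i) - d ord_max / c ord_max * c (widen_ord (leqnSn N) i)) *: e' i).
    by eexists.
  rewrite dE [X in _ - _ *: X]cE scalerDr scalerA divfK // opprD.
  rewrite addrACA subrr addr0 scaler_sumr -sumrB.
  by apply: eq_bigr => i _; rewrite scalerBl scalerA.
by rewrite addrC subrK.
Qed.

Lemma finite_dim_span k (e : 'I_k -> V) : finite_dim (span_of e).
Proof. by apply: (finite_dim_sub_span (e := e)) => //; apply: subspace_span_of. Qed.

Lemma basis_change A B a b (eA : 'I_a -> V) (eB : 'I_b -> V) :
  is_basis eA A -> is_basis eB B -> (forall v, A v -> B v) ->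
  exists C : 'M[K]_(a, b), row_free C /\
    forall i, eA i = \sum_(j < b) C i j *: eB j.
Proof.
move=> hA hB AB.
have /fin_all_exists [C CE] i : exists c : 'I_b -> K, eA i = \sum_(j < b) c j *: eB j.
  by apply/(hB.1 (eA i)); apply: AB; apply: basis_mem hA.
exists (\matrix_(i, j) C i j); split; last first.
  by move=> i; rewrite CE; apply: eq_bigr => j _; rewrite mxE.
apply: inj_row_free => u uC; apply/rowP => i; rewrite mxE.
apply: (hA.2 (u 0)); transitivity (\sum_j (u *m \matrix_(i, j) C i j) 0 j *: eB j).
  under eq_bigr do rewrite CE scaler_sumr.
  rewrite exchange_big; apply: eq_bigr => j _ /=; rewrite mxE scaler_suml.
  by apply: eq_bigr => l _; rewrite mxE scalerA.
by rewrite uC big1 // => j _; rewrite mxE scale0r.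
Qed.

Lemma dim_leq A B a b : has_dim A a -> has_dim B b -> (forall v, A v -> B v) ->
  (a <= b)%N.
Proof.
move=> [eA hA] [eB hB] AB; have [C [fC _]] := basis_change hA hB AB.
by rewrite -(eqP fC) rank_leq_col.
Qed.

Lemma dim_eq A B k : has_dim A k -> has_dim B k -> (forall v, A v -> B v) ->
  forall v, B v -> A v.
Proof.
move=> hA hB AB v Bv; apply: contrapT => nAv.
suff: (k.+1 <= k)%N by rewrite ltnn.
apply: (dim_leq (has_dim_adjoin hA nAv) hB) => _ [a [w [Aw ->]]].
case: (has_dim_subspace hB) => _; apply => //.
exact: AB.
Qed.

End Subspaces.

(** * Polynomial maps into a vector space *)

(** [V] may have infinite dimension. The finite sum says two things at once: all
    the values lie in one finite-dimensional space, which gives local finiteness,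
    and their coordinates are polynomials, which gives regularity of the matrix
    coefficients. *)
Definition polynomial_map (K : fieldType) (d : nat) (V : lmodType K)
    (f : 'rV[K]_d -> V) : Prop :=
  exists (N : nat) (c : 'I_N -> {mpoly K[d]}) (g : 'I_N -> V),
    forall x, f x = \sum_(i < N) (c i).@[fun k => x 0 k] *: g i.

Section PolynomialMaps.
Variables (K : fieldType) (d : nat).
Implicit Types (V : lmodType K) (x : 'rV[K]_d).

Lemma polynomial_map_fin V (I : finType) (c : I -> {mpoly K[d]}) (g : I -> V) f :
  (forall x, f x = \sum_i (c i).@[fun k => x 0 k] *: g i) -> polynomial_map f.
Proof.
move=> fE; exists #|I|, (fun i => c (enum_val i)), (fun i => g (enum_val i)) => x.
by rewrite fE (reindex (@enum_val I I)) //; apply/onW_bij/enum_val_bij.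
Qed.

Lemma polynomial_map_ext V (f f' : 'rV[K]_d -> V) :
  f =1 f' -> polynomial_map f -> polynomial_map f'.
Proof. by move=> ff' [N [c [g E]]]; exists N, c, g => x; rewrite -ff'. Qed.

Lemma polynomial_map_const V (v : V) : polynomial_map (fun _ : 'rV[K]_d => v).
Proof.
by exists 1%N, (fun=> 1), (fun=> v) => x; rewrite big_ord1 meval1 scale1r.
Qed.

Lemma polynomial_map_meval (P : {mpoly K[d]}) :
  polynomial_map (fun x => P.@[fun k => x 0 k] : K^o).
Proof.
by exists 1%N, (fun=> P), (fun=> 1) => x; rewrite big_ord1 [RHS]mulr1.
Qed.

Lemma polynomial_map_coord i : polynomial_map (fun x => x 0 i : K^o).
Proof.
apply: polynomial_map_ext (polynomial_map_meval 'X_i) => x.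
by rewrite mevalXU.
Qed.

Lemma polynomial_map_add V (f g : 'rV[K]_d -> V) :
  polynomial_map f -> polynomial_map g -> polynomial_map (fun x => f x + g x).
Proof.
move=> [N [c [u fE]]] [M [e [v gE]]].
apply: (@polynomial_map_fin _ ('I_N + 'I_M)%type
  (fun s => match s with inl i => c i | inr j => e j end)
  (fun s => match s with inl i => u i | inr j => v j end)) => x.
by rewrite fE gE big_sumType.
Qed.

Lemma polynomial_map_sum V (I : Type) (r : seq I) (P : pred I)
    (f : I -> 'rV[K]_d -> V) :
  (forall i, P i -> polynomial_map (f i)) ->
  polynomial_map (fun x => \sum_(i <- r | P i) f i x).
Proof.
move=> pf; elim: r => [|i r IH].
  by apply: polynomial_map_ext (polynomial_map_const 0) => x; rewrite big_nil.
have [Pi|nPi] := boolP (P i).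
  apply: polynomial_map_ext (polynomial_map_add (pf i Pi) IH) => x.
  by rewrite big_cons Pi.
by apply: polynomial_map_ext IH => x; rewrite big_cons (negbTE nPi).
Qed.

(** Scaling by a polynomial function, the product of an algebra and the Lie bracket
    are all bilinear. *)
Lemma polynomial_map_bilinear V1 V2 V3 (b : V1 -> V2 -> V3)
    (f : 'rV[K]_d -> V1) (g : 'rV[K]_d -> V2) :
  (forall a u v w, b (a *: u + v) w = a *: b u w + b v w) ->
  (forall a u v w, b w (a *: u + v) = a *: b w u + b w v) ->
  polynomial_map f -> polynomial_map g -> polynomial_map (fun x => b (f x) (g x)).
Proof.
move=> bl br [N [c [u fE]]] [M [e [v gE]]].
have b0l w : b 0 w = 0.
  by apply: (addrI (b 0 w)); rewrite -{2}[b 0 w]scale1r addrC -bl scale1r !addr0.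
have b0r w : b w 0 = 0.
  by apply: (addrI (b w 0)); rewrite -{2}[b w 0]scale1r addrC -br scale1r !addr0.
have bsl n (a : 'I_n -> K) h w : b (\sum_(i < n) a i *: h i) w = \sum_(i < n) a i *: b (h i) w.
  elim: n a h => [|n IH] a h; first by rewrite !big_ord0 b0l.
  by rewrite !big_ord_recl bl IH.
have bsr n (a : 'I_n -> K) h w : b w (\sum_(i < n) a i *: h i) = \sum_(i < n) a i *: b w (h i).
  elim: n a h => [|n IH] a h; first by rewrite !big_ord0 b0r.
  by rewrite !big_ord_recl br IH.
apply: (@polynomial_map_fin _ ('I_N * 'I_M)%type
  (fun s => c s.1 * e s.2) (fun s => b (u s.1) (v s.2))) => x.
rewrite fE gE bsl -(pair_bigA _ (fun i j => (c i * e j).@[_] *: b (u i) (v j))) /=.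
apply: eq_bigr => i _; rewrite bsr scaler_sumr; apply: eq_bigr => j _.
by rewrite mevalM scalerA.
Qed.

Lemma polynomial_map_linear V1 V2 (h : V1 -> V2) (f : 'rV[K]_d -> V1) :
  (forall a u v, h (a *: u + v) = a *: h u + h v) ->
  polynomial_map f -> polynomial_map (fun x => h (f x)).
Proof.
move=> hl [N [c [g fE]]]; exists N, c, (fun i => h (g i)) => x; rewrite fE.
have h0 : h 0 = 0.
  by apply: (addrI (h 0)); rewrite -{1}[h 0]scale1r -hl scale1r !addr0.
elim: N c g {fE} => [|N IH] c g; first by rewrite !big_ord0.
by rewrite !big_ord_recl hl IH.
Qed.

Lemma polynomial_map_scale V (a : 'rV[K]_d -> K^o) (f : 'rV[K]_d -> V) :
  polynomial_map a -> polynomial_map f -> polynomial_map (fun x => (a x : K) *: f x).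
Proof.
apply: (polynomial_map_bilinear (V1 := K^o) (b := fun (c : K) u => c *: u)).
  by move=> b u v w; rewrite scalerDl scalerA.
by move=> b u v w; rewrite scalerDr !scalerA mulrC.
Qed.

Lemma polynomial_map_scale_const V (a : K) (f : 'rV[K]_d -> V) :
  polynomial_map f -> polynomial_map (fun x => a *: f x).
Proof.
apply: (polynomial_map_linear (h := fun u => a *: u)) => b u v.
by rewrite scalerDr !scalerA mulrC.
Qed.

Lemma polynomial_map_mul (A : algType K) (f g : 'rV[K]_d -> A) :
  polynomial_map f -> polynomial_map g -> polynomial_map (fun x => f x * g x).
Proof.
apply: polynomial_map_bilinear => a u v w.
  by rewrite mulrDl scalerAl.
by rewrite mulrDr scalerAr.
Qed.

Lemma polynomial_map_prod (A : algType K) (I : Type) (r : seq I)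
    (f : I -> 'rV[K]_d -> A) :
  (forall i, polynomial_map (f i)) ->
  polynomial_map (fun x => \prod_(i <- r) f i x).
Proof.
move=> pf; elim: r => [|i r IH].
  by apply: polynomial_map_ext (polynomial_map_const 1) => x; rewrite big_nil.
apply: polynomial_map_ext (polynomial_map_mul (pf i) IH) => x.
by rewrite big_cons.
Qed.

Lemma polynomial_map_exp (A : algType K) (f : 'rV[K]_d -> A) n :
  polynomial_map f -> polynomial_map (fun x => f x ^+ n).
Proof.
move=> pf; elim: n => [|n IH]; first exact: polynomial_map_const.
by apply: polynomial_map_ext (polynomial_map_mul pf IH) => x; rewrite exprS.
Qed.

Lemma polynomial_map_det (A : comAlgType K) n (M : 'rV[K]_d -> 'M[A]_n) :
  (forall i j, polynomial_map (fun x => M x i j)) ->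
  polynomial_map (fun x => \det (M x)).
Proof.
move=> pM; apply: polynomial_map_sum => s _; apply: polynomial_map_mul.
  exact: polynomial_map_const.
exact: polynomial_map_prod.
Qed.

(** Polynomials are built from their coefficients by sums and products, so
    substituting polynomial families for the variables gives a polynomial family. *)
Lemma polynomial_map_mmap (A : comAlgType K) n (P : {mpoly K[n]})
    (h : 'I_n -> 'rV[K]_d -> A) :
  (forall i, polynomial_map (h i)) ->
  polynomial_map (fun x => \sum_(m <- msupp P) P@_m *: \prod_(i < n) h i x ^+ m i).
Proof.
move=> ph; apply: polynomial_map_sum => m _.
apply: polynomial_map_scale_const.
by apply: polynomial_map_prod => i; apply: polynomial_map_exp.
Qed.

Lemma polynomial_map_comp_mpoly n k (P : {mpoly K[n]})
    (T : 'rV[K]_d -> n.-tuple {mpoly K[k]}) :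
  (forall i, polynomial_map (fun x => tnth (T x) i)) ->
  polynomial_map (fun x => P \mPo T x).
Proof.
move=> pT; apply: polynomial_map_ext (polynomial_map_mmap P pT) => x.
by rewrite comp_mpolyEX; apply: eq_bigr => m _; rewrite comp_mpolyX.
Qed.

Lemma polynomial_map_row n (f : 'rV[K]_d -> 'rV[K]_n) :
  (forall i, polynomial_map (fun x => f x 0 i : K^o)) -> polynomial_map f.
Proof.
move=> pf; apply: (@polynomial_map_ext _ (fun x => \sum_i f x 0 i *: delta_mx 0 i)).
  by move=> x; rewrite -row_sum_delta.
apply: polynomial_map_sum => i _.
by apply: (polynomial_map_scale (pf i)); apply: polynomial_map_const.
Qed.

Lemma polynomial_map_opp : polynomial_map (fun z : 'rV[K]_d => - z).
Proof.
apply: polynomial_map_row => i; exists 1%N, (fun=> 'X_i), (fun=> -1) => x.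
by rewrite big_ord1 mevalXU mxE [RHS]mulrN1.
Qed.

Lemma polynomial_map_entry n (f : 'rV[K]_d -> 'rV[K]_n) i :
  polynomial_map f -> polynomial_map (fun x => f x 0 i : K^o).
Proof.
by apply: (polynomial_map_linear (h := fun v : 'rV[K]_n => v 0 i : K^o)) => a u v; rewrite !mxE.
Qed.

Lemma polynomial_map_meval_comp n (P : {mpoly K[n]}) (h : 'I_n -> 'rV[K]_d -> K) :
  (forall i, polynomial_map (h i : _ -> K^o)) ->
  polynomial_map (fun x => P.@[fun i => h i x] : K^o).
Proof.
move=> ph; apply: polynomial_map_ext (polynomial_map_mmap (A := K^o) P ph) => x.
by rewrite mevalE.
Qed.

Lemma polynomial_map_comp n V (f : 'rV[K]_n -> V) (h : 'rV[K]_d -> 'rV[K]_n) :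
  polynomial_map f -> polynomial_map h -> polynomial_map (fun x => f (h x)).
Proof.
move=> [N [c [g fE]]] ph.
apply: (@polynomial_map_ext _ (fun x => \sum_(i < N) (c i).@[fun k => h x 0 k] *: g i)).
  by move=> x; rewrite fE.
apply: polynomial_map_sum => i _.
apply: polynomial_map_scale; last exact: polynomial_map_const.
by apply: polynomial_map_meval_comp => k; apply: polynomial_map_entry.
Qed.

Lemma polynomial_map_ffun (I : finType) (V : lmodType K) (f : 'rV[K]_d -> {ffun I -> V}) :
  (forall i, polynomial_map (fun x => f x i)) -> polynomial_map f.
Proof.
move=> pf; pose ins i (v : V) : {ffun I -> V} := [ffun j => if j == i then v else 0].
apply: (@polynomial_map_ext _ (fun x => \sum_i ins i (f x i))).
  move=> x; apply/ffunP => j; rewrite sum_ffunE (bigD1 j) //= ffunE eqxx.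
  by rewrite big1 ?addr0 // => i; rewrite ffunE eq_sym => /negbTE ->.
apply: polynomial_map_sum => i _; apply: polynomial_map_linear (pf i) => a u v.
by apply/ffunP => j; rewrite !ffunE; case: eqP => // _; rewrite scaler0 addr0.
Qed.

Lemma polynomial_map_scalarP (f : 'rV[K]_d -> K) :
  polynomial_map (f : _ -> K^o) ->
  exists P : {mpoly K[d]}, forall x, f x = P.@[fun k => x 0 k].
Proof.
move=> [N [c [g fE]]]; exists (\sum_(i < N) g i *: c i) => x.
by rewrite fE raddf_sum; apply: eq_bigr => i _ /=; rewrite mevalZ mulrC.
Qed.

Lemma polynomial_map_line V (f : 'rV[K]_d -> V) v : polynomial_map f ->
  exists N (q : 'I_N -> {poly K}) (g : 'I_N -> V),
    forall t : K, f (t *: v) = \sum_(i < N) (q i).[t] *: g i.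
Proof.
move=> [N [c [g fE]]]; exists N, (fun i => mmap polyC (fun k => v 0 k *: 'X) (c i)), g.
move=> t; rewrite fE; apply: eq_bigr => i _; congr (_ *: _).
rewrite /mmap horner_sum mevalE; apply: eq_bigr => m _.
rewrite hornerCM horner_prod; congr (_ * _); apply: eq_bigr => k _.
by rewrite horner_exp hornerZ hornerX mxE mulrC.
Qed.

End PolynomialMaps.

(** * Polynomials vanishing at integral points, and finite differences *)

Lemma nat_roots_eq0 (K : numFieldType) (q : {poly K}) :
  (forall t : nat, q.[t%:R] = 0) -> q = 0.
Proof.
move=> q0; apply/eqP; apply: contraT => nz.
have := max_poly_roots (rs := [seq (t%:R : K) | t <- iota 0 (size q)]) nz.
rewrite size_map size_iota ltnn => -> //; first by apply/allP => _ /mapP [t _ ->]; apply/rootP.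
by rewrite map_inj_uniq ?iota_uniq // => s t /eqP; rewrite eqr_nat => /eqP.
Qed.

Lemma muni_inj0 (R : comNzRingType) n (P : {mpoly R[n.+1]}) : muni P = 0 -> P = 0.
Proof.
move=> P0; apply/mpolyP => m; rewrite mcoeff0.
have [mP|/memN_msupp_eq0 //] := boolP (m \in msupp P).
pose w := widen_ord (leqnSn n).
have := congr1 (fun q : {poly {mpoly R[n]}} =>
  (q`_(m ord_max))@_[multinom (m (w i)) | i < n]) P0.
rewrite coef0 mcoeff0 muniE coef_sum raddf_sum (bigD1_seq m) //= ?msupp_uniq //.
rewrite big1 => [|m' ne]; last first.
  rewrite coefZ coefXn; case: eqP => [em|]; last by rewrite mulr0 mcoeff0.
  rewrite mulr1 mcoeffZ mcoeffX; case: eqP => [e|]; last by rewrite mulr0.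
  case/eqP: ne; apply/mnmP => i; have [->//|lti] := eqVneq i ord_max.
  have ltin : (i < n)%N.
    rewrite ltn_neqAle -ltnS ltn_ord andbT.
    by apply: contra lti => /eqP ?; apply/eqP/val_inj.
  have -> : i = w (Ordinal ltin) by apply: val_inj.
  by have /mnmP/(_ (Ordinal ltin)) := e; rewrite !mnmE.
by rewrite addr0 coefZ coefXn eqxx mulr1 mcoeffZ mcoeffX eqxx mulr1.
Qed.

Lemma meval_muni (R : comNzRingType) n (P : {mpoly R[n.+1]}) (v : 'I_n.+1 -> R) :
  P.@[v] = (map_poly (meval (fun i => v (widen_ord (leqnSn n) i))) (muni P)).[v ord_max].
Proof.
rewrite muniE rmorph_sum horner_sum mevalE; apply: eq_bigr => m _ /=.
rewrite map_polyZ map_polyXn hornerZ hornerXn /= mevalZ mevalX -mulrA.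
rewrite big_ord_recr /=; congr (_ * (_ * _)).
by apply: eq_bigr => i _; rewrite mnmE.
Qed.

(** One variable is removed at a time: with the others fixed at natural numbers, a
    polynomial in the last variable has infinitely many roots. *)
Lemma mpoly_nat_eq0 (K : numFieldType) n (P : {mpoly K[n]}) :
  (forall v : 'I_n -> nat, P.@[fun i => (v i)%:R] = 0) -> P = 0.
Proof.
elim: n P => [|n IH] P P0.
  have PC : P = (P@_0)%:MP.
    apply/mpolyP => m; rewrite mcoeffC; have -> : m = 0%MM by apply/mnmP => -[].
    by rewrite eqxx mulr1.
  by have := P0 (fun=> 0%N); rewrite PC mevalC => ->; rewrite mpolyC0.
apply: muni_inj0; apply/polyP => k; rewrite coef0; apply: IH => v.
pose w (t : nat) (i : 'I_n.+1) : nat := if insub (val i) is Some j then v j else t.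
have wE t i : w t (widen_ord (leqnSn n) i) = v i by rewrite /w /= valK.
have wM t : w t ord_max = t by rewrite /w insubF //= ltnn.
pose q := map_poly (meval (fun i => (v i)%:R)) (muni P).
suff: q = 0 by move=> /(congr1 (fun r : {poly K} => r`_k)); rewrite coef_map coef0.
apply: nat_roots_eq0 => t; have := P0 (w t); rewrite meval_muni wM => <-.
congr (_.[_]); apply: eq_map_poly => r; apply: meval_eq => i.
by rewrite wE.
Qed.

Lemma size_poly_difference (K : fieldType) (q : {poly K}) :
  (size (q \Po ('X + 1%:P) - q)%R <= (size q).-1)%N.
Proof.
elim/poly_ind: q => [|q c IH]; first by rewrite comp_poly0 subrr size_poly0.
have [->|nz] := eqVneq q 0; first by rewrite mul0r add0r comp_polyC subrr size_poly0.
rewrite comp_poly_MXaddC.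
have -> : (q \Po ('X + 1%:P)) * ('X + 1%:P) + c%:P - (q * 'X + c%:P) =
    (q \Po ('X + 1%:P) - q) * 'X + (q \Po ('X + 1%:P)).
  by rewrite mulrDr mulr1 mulrBl opprD addrACA subrr addr0 addrAC.
rewrite size_MXaddC (negbTE nz) /=; apply: leq_trans (size_polyD _ _) _.
rewrite geq_max size_comp_poly2 ?size_XaddC // leqnn andbT.
apply: leq_trans (size_polyMleq _ _) _; rewrite size_polyX addn2 /=.
by rewrite -(prednK (_ : 0 < size q)%N) ?size_poly_gt0 // ltnS.
Qed.

(** The powers of [T] on the orbit of [f 0] are polynomial in the exponent, and
    [T - 1] acts on them as the finite difference, which lowers the degree. *)
Lemma difference_nilpotent (K : fieldType) (V : lmodType K) (T : V -> V) N :
  (forall a u v, T (a *: u + v) = a *: T u + T v) ->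
  forall M (q : 'I_M -> {poly K}) (g : 'I_M -> V) (f : nat -> V),
  (forall i, size (q i) <= N)%N ->
  (forall j, f j = \sum_(i < M) (q i).[j%:R] *: g i) ->
  (forall j, T (f j) = f j.+1) ->
  iter N (fun v => T v - v) (f 0%N) = 0.
Proof.
move=> Tl; elim: N => [|N IH] M q g f sq fE Tf.
  rewrite /= fE big1 // => i _; move: (sq i); rewrite leqn0 size_poly_eq0 => /eqP ->.
  by rewrite horner0 scale0r.
rewrite iterSr Tf.
apply: (IH M (fun i => q i \Po ('X + 1%:P) - q i) g (fun j => f j.+1 - f j)).
- move=> i; apply: leq_trans (size_poly_difference _) _.
  by rewrite -ltnS; case: (size (q i)) (sq i).
- move=> j; rewrite !fE -sumrB; apply: eq_bigr => i _.
  by rewrite -scalerBl hornerD hornerN horner_comp !hornerE natr1.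
- by move=> j /=; rewrite -scaleN1r addrC Tl scaleN1r addrC !Tf.
Qed.


(** * The Baker-Campbell-Hausdorff product *)

Section BCH.
Variables (K : numFieldType) (d : nat) (br : 'rV[K]_d -> 'rV[K]_d -> 'rV[K]_d).
Hypothesis br_lie : is_lie_bracket br.
Implicit Types (x y z : 'rV[K]_d) (s : seq 'rV[K]_d).

Lemma lie_linl a x y z : br (a *: x + y) z = a *: br x z + br y z.
Proof. by case: br_lie. Qed.

Lemma lie_linr a x y z : br x (a *: y + z) = a *: br x y + br x z.
Proof. by case: br_lie. Qed.

Lemma lie_xx x : br x x = 0. Proof. by case: br_lie. Qed.

Lemma lie_addl x y z : br (x + y) z = br x z + br y z.
Proof. by rewrite -[x]scale1r lie_linl !scale1r. Qed.

Lemma lie_addr x y z : br x (y + z) = br x y + br x z.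
Proof. by rewrite -[y]scale1r lie_linr !scale1r. Qed.

Lemma lie_0l x : br 0 x = 0.
Proof. by apply: (addrI (br 0 x)); rewrite -lie_addl !addr0. Qed.

Lemma lie_0r x : br x 0 = 0.
Proof. by apply: (addrI (br x 0)); rewrite -lie_addr !addr0. Qed.

Lemma lie_scalel a x y : br (a *: x) y = a *: br x y.
Proof. by rewrite -[a *: x]addr0 lie_linl lie_0l addr0. Qed.

Lemma lie_scaler a x y : br x (a *: y) = a *: br x y.
Proof. by rewrite -[a *: y]addr0 lie_linr lie_0r addr0. Qed.

Lemma lie_anti x y : br y x = - br x y.
Proof.
have := lie_xx (x + y); rewrite lie_addl !lie_addr !lie_xx add0r addr0.
by move/eqP; rewrite addrC addr_eq0 => /eqP.
Qed.

Section Ideal.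
Variable I : 'rV[K]_d -> Prop.
Hypotheses (sI : subspace I) (idI : forall z u, I u -> I (br z u)).

(** The innermost bracket of two letters is zero or [br x y] up to sign. *)
Lemma nested_bracket_ideal x y s :
  I (br x y) -> {in s, forall z, z = x \/ z = y} -> (1 < size s)%N ->
  I (nested_bracket br s).
Proof.
move=> Ixy; elim: s => [//|z [//|z' s] IH] sxy _; case: s => [|z'' s] in IH sxy *.
  have [I0 _] := sI.
  have zE := sxy z (mem_head _ _); have zE' : z' = x \/ z' = y.
    by apply: sxy; rewrite !inE eqxx orbT.
  case: zE zE' => -> [] -> /=; rewrite ?lie_xx //.
  by rewrite lie_anti; apply: subspace_opp.
by apply/idI/IH => // w ws; apply: sxy; rewrite inE ws orbT.
Qed.

Lemma dynkin_word_letters x y t : {in dynkin_word x y t, forall z, z = x \/ z = y}.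
Proof.
move=> z /flatten_mapP [q _]; rewrite mem_cat !mem_nseq.
by case/orP => /andP [_ /eqP ->]; [left|right].
Qed.

Lemma size_dynkin_word x y (t : seq ('I_d.+1 * 'I_d.+1)) :
  all (fun q : 'I_d.+1 * 'I_d.+1 => 0 < q.1 + q.2)%N t ->
  (size t <= size (dynkin_word x y t))%N.
Proof.
elim: t => [//|q t IH] /= /andP [q0 /IH lt].
rewrite /dynkin_word /= size_cat size_cat !size_nseq -addn1 addnC.
exact: leq_add.
Qed.

(** Modulo an ideal in which [x] and [y] commute, every bracket of two or more
    letters [x], [y] vanishes, and only the two words of length one survive. *)
Lemma bch_first_order x y : I (br x y) -> I (bch br x y - (x + y)).
Proof.
move=> Ixy; have [I0 _] := sI; rewrite /bch.
have [d0|d_gt0] := posnP d.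
  by rewrite [X in I X](_ : _ = 0) //; apply/rowP => -[i lti]; exfalso; rewrite d0 in lti.
have nest (t : seq ('I_d.+1 * 'I_d.+1)) : (1 < size (dynkin_word x y t))%N ->
    I (nested_bracket br (dynkin_word x y t)).
  by move=> ?; apply: (nested_bracket_ideal Ixy) => //; apply: dynkin_word_letters.
(* The words of length one come from [k = 1] and the exponents (1, 0) and (0, 1). *)
pose o1 : 'I_d.+1 := Ordinal (d_gt0 : (1 < d.+1)%N).
rewrite big_ltn // addrAC; apply: subspace_add => //; last first.
  rewrite big_nat_cond; apply: subspace_sum => // k /andP [/andP [k_gt1 _] _].
  apply: subspace_sum => // t /andP [tpos _]; apply: subspace_scale => //.
  apply: nest; apply: leq_trans k_gt1 _.
  by rewrite -[X in (X <= _)%N](size_tuple t) size_dynkin_word.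
rewrite (bigD1 [tuple (o1, ord0)]) /=; last by rewrite d_gt0.
rewrite (bigD1 [tuple (ord0, o1)]) /=; last by rewrite d_gt0.
rewrite !big_seq1 /= !muln1 !divr1 !scale1r addrA [x + y + _]addrC addrK.
apply: subspace_sum => // -[[|[q1 q2] [|//]] // st] /=.
move=> /andP [/andP [/andP [qpos _] tN1] tN2]; apply: subspace_scale => //.
apply: nest; rewrite /dynkin_word /= cats0 size_cat !size_nseq.
move: qpos tN1 tN2; rewrite -!val_eqE /= !eqseq_cons !andbT !xpair_eqE -!val_eqE /=.
by case: (val q1) (val q2) => [|[|?]] [|[|?]].
Qed.

End Ideal.

(** Two vectors of a line commute, so the product of their exponentials is the
    exponential of the sum. *)
Lemma bch_line (a b : K) x : bch br (a *: x) (b *: x) = (a + b) *: x.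
Proof.
have : bch br (a *: x) (b *: x) - (a *: x + b *: x) = 0.
  apply: (bch_first_order (I := fun v => v = 0)).
  - by split=> [//|c u v -> ->]; rewrite scaler0 addr0.
  - by move=> z u ->; rewrite lie_0r.
  - by rewrite lie_scalel lie_scaler lie_xx !scaler0.
by move=> /eqP; rewrite subr_eq0 scalerDl => /eqP.
Qed.

Lemma subspace_lower_central k : subspace (lower_central br k).
Proof. by case: k => [|k]; [split|apply: subspace_lspan]. Qed.

Lemma lower_central_br k z u :
  lower_central br k u -> lower_central br k.+1 (br z u).
Proof. by move=> uk; apply: lspan_gen; exists z, u. Qed.

Lemma lower_central_desc k u : lower_central br k.+1 u -> lower_central br k u.
Proof.
elim: k u => [//|k IH] u; apply: lspan_sub; first exact: subspace_lower_central.
by move=> _ [x [y [yk ->]]]; apply/lower_central_br/IH.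
Qed.

Lemma lower_central_ideal k z u :
  lower_central br k u -> lower_central br k (br z u).
Proof. by move=> uk; apply/lower_central_desc/lower_central_br. Qed.

(** Since [br x y] lies in the next term, both products are [x + y] modulo that
    term. *)
Lemma bch_commutes_mod k x y : lower_central br k y ->
  lower_central br k.+1 (bch br x y - bch br y x).
Proof.
move=> yk; have sI := subspace_lower_central k.+1.
have idI z u := @lower_central_ideal k.+1 z u.
have xy : lower_central br k.+1 (br x y) by apply: lower_central_br.
rewrite -[bch br x y](subrK (x + y)) -addrA -[X in _ + X]opprB.
apply: subspace_sub => //; first exact: bch_first_order.
rewrite [x + y]addrC; apply: bch_first_order => //.
by rewrite lie_anti; apply: subspace_opp.
Qed.

(** The bracket of [- y] and [x] equals that of [- y] and [x - y], hence lies in the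
    ideal, and modulo the ideal only the sum [x - y] remains. *)
Lemma bch_opp_mod k x y : lower_central br k (x - y) ->
  lower_central br k (bch br (- y) x).
Proof.
move=> xy; have sI := subspace_lower_central k.
rewrite -[bch _ _ _](subrK (- y + x)); apply: subspace_add => //; last by rewrite addrC.
apply: bch_first_order => // [z u|]; first exact: lower_central_ideal.
rewrite -[x](subrK y) lie_addr -[X in br X y]scaleN1r lie_scalel lie_xx scaler0 addr0.
exact: lower_central_ideal.
Qed.

End BCH.

Section BCHmorphism.
Variables (K L : numFieldType) (f : {rmorphism K -> L}) (d : nat).
Variables (brK : 'rV[K]_d -> 'rV[K]_d -> 'rV[K]_d).
Variables (brL : 'rV[L]_d -> 'rV[L]_d -> 'rV[L]_d).
Hypothesis brE : forall x y, brL (map_mx f x) (map_mx f y) = map_mx f (brK x y).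

Lemma nested_bracket_map s :
  nested_bracket brL [seq map_mx f z | z <- s] = map_mx f (nested_bracket brK s).
Proof.
elim: s => [|z [|z' s] IH] //=; first by rewrite map_mx0.
by rewrite -brE -IH.
Qed.

Lemma dynkin_word_map (x y : 'rV[K]_d) t :
  dynkin_word (map_mx f x) (map_mx f y) t = [seq map_mx f z | z <- dynkin_word x y t].
Proof.
rewrite /dynkin_word map_flatten -map_comp; congr flatten.
by apply: eq_map => q /=; rewrite map_cat !map_nseq.
Qed.

Lemma bch_map x y : bch brL (map_mx f x) (map_mx f y) = map_mx f (bch brK x y).
Proof.
rewrite /bch raddf_sum; apply: eq_bigr => k _; rewrite raddf_sum.
apply: eq_big => [t|t _]; first by rewrite dynkin_word_map size_map.
rewrite /= map_mxZ dynkin_word_map size_map nested_bracket_map; congr (_ *: _).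
by rewrite fmorph_div rmorphXn rmorphN1 rmorph_nat.
Qed.

End BCHmorphism.

(** * The exponential chart *)

Section ExponentialChart.
Variables (K : numFieldType) (d : nat) (H : sc_nilpotent_group K d).

Lemma exp_line (a b : K) v : (exp H (a *: v) * exp H (b *: v))%g = exp H ((a + b) *: v).
Proof. by rewrite expM (bch_line (bracket_lie H)). Qed.

Lemma exp0 : exp H 0 = 1%g.
Proof.
have := exp_line 0 0 0; rewrite addr0 scale0r => /(congr1 (fun z => (exp H 0)^-1 * z)%g).
by rewrite mulKg mulVg.
Qed.

Lemma expN v : exp H (- v) = (exp H v)^-1%g.
Proof.
apply/esym/mulg1_eq; rewrite -[X in (exp H X * _)%g]scale1r -scaleN1r exp_line.
by rewrite subrr scale0r exp0.
Qed.

Lemma logV (x : H) : log x^-1%g = - log x.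
Proof. by rewrite -[x in LHS]logK -expN expK. Qed.

(** In coordinates, with [v] the logarithm of [x], the commutator is the product of
    the opposite of [bch v y] with [bch y v], and these two vectors agree modulo the
    next term. *)
Lemma exp_commutator k (x : H) y : lower_central (bracket H) k y ->
  exists2 z, lower_central (bracket H) k.+1 z &
    (exp H y * x = x * exp H y * exp H z)%g.
Proof.
move=> yk; rewrite -[x]logK; set v := log x.
exists (bch (bracket H) (- bch (bracket H) v y) (bch (bracket H) y v)).
  apply: (bch_opp_mod (bracket_lie H)); rewrite -opprB.
  apply: subspace_opp; first exact: subspace_lower_central.
  exact: (bch_commutes_mod (bracket_lie H)).
by rewrite -expM expN -!expM mulVKg.
Qed.

End ExponentialChart.

(** * Linear actions with polynomial orbit maps *)

Section PolynomialAction.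
Variables (K : numFieldType) (d : nat) (H : sc_nilpotent_group K d).
Variables (V : lmodType K) (act : H -> V -> V).
Hypothesis act_linear : linear_action act.
Hypothesis act_polynomial : forall v, polynomial_map (fun z => act (exp H z) v).
Implicit Types (U A S : V -> Prop).

Lemma act_lin x a u v : act x (a *: u + v) = a *: act x u + act x v.
Proof. by case: act_linear. Qed.

Lemma act1 v : act 1%g v = v. Proof. by case: act_linear. Qed.

Lemma actM x y v : act (x * y)%g v = act x (act y v).
Proof. by case: act_linear. Qed.

Lemma actD x u v : act x (u + v) = act x u + act x v.
Proof. by rewrite -[u]scale1r act_lin !scale1r. Qed.

Lemma act0 x : act x 0 = 0.
Proof. by apply: (addrI (act x 0)); rewrite -actD !addr0. Qed.

Lemma actZ x a u : act x (a *: u) = a *: act x u.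
Proof. by rewrite -[a *: u]addr0 act_lin act0 addr0. Qed.

Lemma actB x u v : act x (u - v) = act x u - act x v.
Proof. by rewrite -scaleN1r actD actZ scaleN1r. Qed.

Lemma act_sum x k (c : 'I_k -> K) (e : 'I_k -> V) :
  act x (\sum_(i < k) c i *: e i) = \sum_(i < k) c i *: act x (e i).
Proof.
elim: k c e => [|k IH] c e; first by rewrite !big_ord0 act0.
by rewrite !big_ord_recl act_lin IH.
Qed.

Lemma orbits_in_finite_span r (u : 'I_r -> V) :
  exists N (g : 'I_N -> V), forall x j, span_of g (act x (u j)).
Proof.
elim: r u => [|r IH] u; first by exists 0%N, (fun=> 0) => x [].
have [N [g gP]] := IH (fun i => u (lift ord0 i)).
have [M [c [h hE]]] := act_polynomial (u ord0).
have [k [gk hk]] := span_of_join g h.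
exists (N + M)%N, k => x j; case: (unliftP ord0 j) => [i|] ->; first exact/gk/gP.
by apply: hk; exists (fun i => (c i).@[fun l => log x 0 l]); rewrite -hE logK.
Qed.

Lemma stable_orbit_span D : stable act (orbit_span act D).
Proof.
move=> x v [k [c [u [Su ->]]]]; exists k, c, (fun i => act x (u i)); split.
  move=> i; have [y [w [Dw ->]]] := Su i.
  by exists (x * y)%g, w; rewrite actM.
by rewrite act_sum.
Qed.

Lemma orbit_span_gen D v : D v -> orbit_span act D v.
Proof. by move=> Dv; apply: lspan_gen; exists 1%g, v; rewrite act1. Qed.

(** The orbit of each of finitely many generators of [D] stays in a fixed
    finite-dimensional space. *)
Lemma finite_dim_orbit_span D r (u : 'I_r -> V) :
  (forall v, D v -> span_of u v) -> finite_dim (orbit_span act D).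
Proof.
move=> Du; have [N [g gP]] := orbits_in_finite_span u.
apply: (finite_dim_sub_span (e := g)); first exact: subspace_lspan.
have sg := subspace_span_of g.
apply: lspan_sub => // _ [x [v [/Du [c ->] ->]]]; rewrite act_sum.
by apply: subspace_sum => // i _; apply: subspace_scale.
Qed.

Lemma polynomial_action_locally_finite : locally_finite act.
Proof.
move=> v; exists (orbit_span act (fun u => u = v)); split.
- apply: (finite_dim_orbit_span (u := fun _ : 'I_1 => v)) => _ ->.
  exact: (span_of_gen (fun _ : 'I_1 => v) ord0).
- exact: stable_orbit_span.
- exact: orbit_span_gen.
Qed.

(** The orbit of a basis vector is a sum [c_l(z) *: g_l] with polynomial [c_l], where
    the [g_l] need not lie in [U]. In a basis [b] of a finite-dimensional space
    containing [U] and the [g_l], a left inverse of the coordinates of the basis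
    of [U] turns this sum into polynomial matrix entries. The inverse determinant is
    the determinant at the inverse element, which has opposite coordinates. *)
Lemma polynomial_action_algebraic U :
  stable act U -> algebraic_on (@regular_function K d H) act U.
Proof.
move=> stU k e eU.
have /choice [M ME] x : exists Mx : 'M[K]_k,
    forall j, act x (e j) = \sum_(i < k) Mx i j *: e i.
  have /fin_all_exists [c cE] j : exists c : 'I_k -> K,
      act x (e j) = \sum_(i < k) c i *: e i.
    by apply/eU.1/stU/(basis_mem j eU).
  exists (\matrix_(i, j) c j i) => j; rewrite cE.
  by apply: eq_bigr => i _; rewrite mxE.
have MM x y : M (x * y)%g = M x *m M y.
  apply/matrixP => i j; rewrite mxE.
  apply: (basis_inj (c := fun i => M (x * y)%g i j)
    (d := fun i => \sum_l M x i l * M y l j) eU).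
  rewrite -ME actM ME act_sum.
  under eq_bigr do rewrite ME scaler_sumr.
  rewrite exchange_big; apply: eq_bigr => l _ /=; rewrite scaler_suml.
  by apply: eq_bigr => q _; rewrite scalerA mulrC.
have M1 : M 1%g = 1%:M.
  apply/matrixP => i j.
  apply: (basis_inj (c := fun i => M 1%g i j) (d := fun i => (1%:M : 'M_k) i j) eU).
  rewrite -ME act1 (bigD1 j) //= mxE eqxx scale1r big1 ?addr0 // => l /negbTE ne.
  by rewrite mxE ne scale0r.
have MV x : M x *m M x^-1%g = 1%:M by rewrite -MM mulgV.
have MU x : M x \in unitmx by have [] := mulmx1_unit (MV x).
have polM i j : polynomial_map (fun z => M (exp H z) i j : K^o).
  have [N [c [g gE]]] := act_polynomial (e j).
  have [w [ew gw]] := span_of_join e g.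
  have [r [b bW]] := finite_dim_span w.
  have [E [fE eE]] := basis_change eU bW (fun v Uv => ew v ((eU.1 v).1 Uv)).
  have /fin_all_exists [G GE] l : exists c : 'I_r -> K, g l = \sum_(q < r) c q *: b q.
    by apply/bW.1/gw/span_of_gen.
  pose Gm := (\matrix_(l, q) G l q) *m pinvmx E.
  apply: (polynomial_map_ext (f := fun z =>
      \sum_(l < N) (c l).@[fun k => z 0 k] *: (Gm l i : K^o))); last first.
    by exists N, c, (fun l => Gm l i : K^o).
  move=> z; pose m : 'rV[K]_k := \row_i M (exp H z) i j.
  pose cz : 'rV[K]_N := \row_l (c l).@[fun k => z 0 k].
  have mE : m *m E = cz *m (\matrix_(l, q) G l q).
    apply/rowP => q; rewrite !mxE.
    apply: (basis_inj (c := fun q => \sum_l m 0 l * E l q)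
      (d := fun q => \sum_l cz 0 l * (\matrix_(l, q) G l q) l q) bW).
    transitivity (act (exp H z) (e j)); last rewrite gE.
      rewrite ME; under [RHS]eq_bigr do rewrite eE scaler_sumr.
      rewrite [RHS]exchange_big; apply: eq_bigr => l _ /=; rewrite scaler_suml.
      by apply: eq_bigr => s _; rewrite scalerA mxE.
    under eq_bigr do rewrite GE scaler_sumr.
    rewrite exchange_big; apply: eq_bigr => l _ /=; rewrite scaler_suml.
    by apply: eq_bigr => s _; rewrite scalerA !mxE.
  have := congr1 (fun X => (X *m pinvmx E) 0 i) mE.
  rewrite -!mulmxA mulmxVp // mulmx1 [m _ _]mxE => ->.
  by rewrite mxE; apply: eq_bigr => l _; rewrite [cz _ _]mxE.
exists M; split=> //; split=> //; split=> //; split=> [i j|].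
  have [P PE] := polynomial_map_scalarP (polM i j).
  by exists P => x; rewrite -PE logK.
have detV x : (\det (M x))^-1 = \det (M x^-1%g).
  have := congr1 determinant (MV x); rewrite det_mulmx det1.
  by move=> /(congr1 ( *%R (\det (M x))^-1)); rewrite mulKr ?mulr1 // -unitmxE.
have pdet := polynomial_map_det (A := K^o) (M := fun z => M (exp H z)) polM.
have [P PE] := polynomial_map_scalarP (polynomial_map_comp pdet (polynomial_map_opp _ _)).
by exists P => x; rewrite -PE -logV logK detV.
Qed.

(** The powers of [exp z] run along the line through [z], where the orbit map is
    a polynomial in the exponent. *)
Lemma act_pointwise_unipotent x v : exists N, iter N (fun w => act x w - w) v = 0.
Proof.
rewrite -[x]logK; set z := log x.
have [M [q [g qE]]] := polynomial_map_line z (act_polynomial v).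
exists (\max_i size (q i))%N; rewrite -[v in LHS]act1 -(exp0 H) -(scale0r z).
apply: (difference_nilpotent (act_lin (exp H z)) (q := q) (g := g)
  (f := fun j : nat => act (exp H (j%:R *: z)) v)).
- by move=> i; apply: leq_bigmax.
- by move=> j; rewrite qE.
- by move=> j; rewrite -actM -[X in exp H X]scale1r exp_line nat1r.
Qed.

(** A smallest stable subspace [S] of [U] not contained in [A] is acted on
    trivially modulo [A]: by descent along the lower central series, an element of
    one term centralizes the group modulo elements already known to act trivially,
    so its fixed vectors modulo [A] are again stable, and by unipotence they are
    not all in [A]. *)
Lemma invariant_vector_mod U A k : has_dim U k -> stable act U ->
  subspace A -> stable act A -> (forall v, A v -> U v) -> ~ (forall v, U v -> A v) ->
  exists2 u, U u /\ ~ A u & forall x, A (act x u - u).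
Proof.
(* The minimal [S] is reached by induction on the dimension: [U] is renamed [S], and
   a failure of minimality yields a smaller [T] to which induction applies. *)
elim/ltn_ind: k U => k IH S hS stS sA stA AS SA; have sS := has_dim_subspace hS.
apply: contrapT => nfix.
pose trivial_term i := forall y v, lower_central (bracket H) i y -> S v ->
  A (act (exp H y) v - v).
have descent i : trivial_term i.+1 -> trivial_term i.
  move=> triv y v yi Sv; apply: contrapT => nAv.
  (* The vectors of [S] fixed by [exp H y] modulo [A]; [v] is not one of them. *)
  pose T w := S w /\ A (act (exp H y) w - w).
  have sT : subspace T.
    split=> [|a u w [Su Au] [Sw Aw]]; first by split; [case: sS|rewrite act0 subr0; case: sA].
    split; first by case: sS => _; apply.
    rewrite act_lin opprD addrACA -scalerBr.
    by case: sA => _; apply.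
  have stT : stable act T.
    move=> x w [Sw Aw]; split; first exact: stS.
    have [z zi e] := exp_commutator x yi.
    have -> : act (exp H y) (act x w) - act x w =
        act x (act (exp H y) (act (exp H z) w - w)) + act x (act (exp H y) w - w).
      by rewrite -actM e !actM !actB addrA subrK.
    by apply: subspace_add => //; do ?apply: (stA) => //; apply: triv.
  have [e [eS _]] := hS.
  have [t hT] : finite_dim T.
    by apply: (finite_dim_sub_span (e := e)) => // w [Sw _]; apply/eS.
  have tk : (t < k)%N.
    rewrite ltn_neqAle (dim_leq hT hS) => [|w []//]; rewrite andbT.
    apply/eqP => tk; rewrite tk in hT; apply: nAv.
    by have [] := dim_eq hT hS (fun w => @proj1 _ _) Sv.
  (* The last vector outside [A] in the iterates of [exp H y - 1]. *)
  have [w [Sw Aw]] : exists w, S w /\ ~ A w /\ A (act (exp H y) w - w).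
    move/existsNP: SA => [w /not_implyP [Sw nAw]].
    have [N] := act_pointwise_unipotent (exp H y) w.
    elim: N w Sw nAw => [|N IHN] w Sw nAw; first by move=> /= w0; case: nAw; rewrite w0; case: sA.
    rewrite iterSr; have [Aw|nAw'] := pselect (A (act (exp H y) w - w)); first by exists w.
    by apply: IHN => //; apply: subspace_sub => //; apply: stS.
  have [||u [[Su _] nAu] fix_u] := IH t tk T hT stT sA stA; last by apply: nfix; exists u.
    move=> u Au; split; first exact: AS.
    by apply: subspace_sub => //; apply: stA.
  by move=> TA; case: Aw => nAw Aw; apply: nAw; apply: TA.
have [c c0] := bracket_nilpotent H.
have triv_c : trivial_term c.
  move=> y v /c0 -> Sv; rewrite exp0 act1 subrr; by case: sA.
have triv0 : trivial_term 0%N by elim: c triv_c {c0} => // c IHc /descent.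
move/existsNP: SA => [w /not_implyP [Sw nAw]]; apply: nfix; exists w => // x.
by rewrite -[x]logK; apply: triv0.
Qed.

(** Each step of the flag adjoins to the previous one a vector that is invariant
    modulo it. *)
Lemma polynomial_action_trivial_flag U k :
  has_dim U k -> stable act U -> has_trivial_flag act U.
Proof.
move=> hU stU; pose flag a := exists Fl : nat -> V -> Prop,
  (forall i, (i <= a)%N -> [/\ has_dim (Fl i) i, stable act (Fl i) & forall v, Fl i v -> U v]) /\
  (forall i, (i < a)%N ->
       (forall v, Fl i v -> Fl i.+1 v) /\
       (forall x v, Fl i.+1 v -> Fl i (act x v - v))).
suff /(_ k (leqnn k)) [Fl [dimFl stepFl]] : forall a, (a <= k)%N -> flag a.
  exists k, Fl; split; last by split=> // i /dimFl [].
  have [hk _ FU] := dimFl _ (leqnn k).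
  by move=> v; split; [apply: FU | apply: (dim_eq hk hU)].
elim=> [_|a IH ltak].
  exists (fun _ v => v = 0); split=> // i; rewrite leqn0 => /eqP ->.
  split; [exact: has_dim0|by move=> x v ->; rewrite act0|].
  by move=> v ->; case: (has_dim_subspace hU).
have [Fl [dimFl stepFl]] := IH (ltnW ltak).
have [ha sta FU] := dimFl a (leqnn a); have sFa := has_dim_subspace ha.
have nUF : ~ (forall v, U v -> Fl a v).
  by move=> UF; have := dim_leq hU ha UF; rewrite leqNgt ltak.
have [u [Uu nFu] fix_u] := invariant_vector_mod hU stU sFa sta FU nUF.
pose A' v := exists c w, Fl a w /\ v = c *: u + w.
have actA' x v : A' v -> Fl a (act x v - v).
  move=> [c [w [Fw ->]]]; rewrite act_lin opprD addrACA -scalerBr.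
  case: (sFa) => _; apply; first exact: fix_u.
  by apply: subspace_sub => //; apply: sta.
have FA' v : Fl a v -> A' v by move=> Fv; exists 0, v; rewrite scale0r add0r.
have hA' : has_dim A' a.+1 by apply: has_dim_adjoin.
have sA' := has_dim_subspace hA'.
exists (fun i => if (i <= a)%N then Fl i else A'); split=> i.
  case: (leqP i a) => [lei _|lti lei]; first exact: dimFl.
  have -> : i = a.+1 by apply/eqP; rewrite eqn_leq lei lti.
  split=> //; last first.
    by move=> v [c [w [Fw ->]]]; case: (has_dim_subspace hU) => _; apply=> //; apply: FU.
  by move=> x v A'v; rewrite -[act x v](subrK v); apply: subspace_add => //; apply/FA'/actA'.
move=> ltia; have /predU1P [->|lti] : (i == a) || (i < a)%N by rewrite -leq_eqVlt.
  by rewrite leqnn ltnn.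
by rewrite lti (ltnW lti); apply: stepFl.
Qed.

Lemma trivial_flag_unipotent U x :
  has_trivial_flag act U -> stable act U -> unipotent_on (act x) U.
Proof.
move=> [k [Fl [FU [dimFl stepFl]]]] stU; split; first exact: stU.
exists k => u /FU; elim: k {FU} => [|k IH] in dimFl stepFl u *.
  by have [[e [eF _]] _] := dimFl 0%N isT; move=> /eF [c ->]; rewrite big_ord0.
move=> Fu; rewrite iterSr; apply: IH.
- by move=> i lei; apply: dimFl; apply: leqW.
- by move=> i lti; apply: stepFl; apply: leqW.
- by have [_] := stepFl k (ltnSn k); apply.
Qed.

Lemma polynomial_action_rational :
  rational_module (@regular_function K d H) act.
Proof.
split; [exact: act_linear|exact: polynomial_action_locally_finite|].
by move=> U _; apply: polynomial_action_algebraic.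
Qed.

Lemma polynomial_action_locally_unipotent : locally_unipotent act.
Proof. by move=> U [k hU]; apply: polynomial_action_trivial_flag hU. Qed.

Lemma polynomial_action_submodule U : finite_dim U -> stable act U ->
  unipotent_rep (@regular_function K d H) act U /\ has_trivial_flag act U.
Proof.
move=> fU stU; have flU := polynomial_action_locally_unipotent fU stU.
split=> //; split; first exact: polynomial_action_algebraic.
by move=> x; apply: trivial_flag_unipotent.
Qed.

End PolynomialAction.

(** * Pullback of polynomial differential forms *)

Section CauchyBinet.
Variables (R : comNzRingType) (n p : nat).
Implicit Types (I : multi_index n p) (s : 'S_p).

Lemma multi_index_sorted I : sorted (relpre (val : 'I_n -> nat) ltn) (val I).
Proof. by rewrite -sorted_map; exact: (valP I). Qed.

Lemma multi_index_uniq I : uniq (val I).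
Proof.
apply: (sorted_uniq _ _ (multi_index_sorted I)); first by move=> ? ? ?; apply: ltn_trans.
by move=> ?; apply: ltnn.
Qed.

Lemma multi_index_tnth_inj I : injective (tnth (val I)).
Proof. exact/tuple_uniqP/multi_index_uniq. Qed.

Lemma multi_index_eq I I' : (forall i, tnth (val I) i \in (val I' : seq 'I_n)) -> I = I'.
Proof.
move=> II'; apply/val_inj/val_inj => /=.
apply: (irr_sorted_eq _ _ (multi_index_sorted I) (multi_index_sorted I')).
- by move=> ? ? ?; apply: ltn_trans.
- by move=> ?; apply: ltnn.
have sub : {subset (val I : seq 'I_n) <= (val I' : seq 'I_n)}.
  by move=> _ /tnthP [i ->].
by have [] := uniq_min_size (multi_index_uniq I) sub; rewrite ?size_tuple.
Qed.

(** An increasing multi-index and a permutation encode an injective map from rows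
    to columns. *)
Definition arrangement (Is : multi_index n p * 'S_p) : {ffun 'I_p -> 'I_n} :=
  [ffun a => tnth (val Is.1) (Is.2 a)].

Lemma arrangement_inj : injective arrangement.
Proof.
move=> [I s] [I' s'] /ffunP eqIs.
have eqI : I = I'.
  apply: multi_index_eq => i; have := eqIs ((s^-1)%g i); rewrite !ffunE /= permKV => ->.
  exact: mem_tnth.
congr pair => //; apply/permP => a; have := eqIs a; rewrite !ffunE /= -eqI.
exact: multi_index_tnth_inj.
Qed.

Lemma arrangement_onto (f : {ffun 'I_p -> 'I_n}) : injective f ->
  exists Is, f = arrangement Is.
Proof.
move=> f_inj; pose t := enum (mem (codom f)).
have szt : size t == p by rewrite -cardE card_codom // card_ord.
have st : sorted ltn [seq val i | i <- Tuple szt].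
  rewrite sorted_map /= /t /enum_mem; apply: sorted_filter.
    by move=> ? ? ?; apply: ltn_trans.
  by rewrite -sorted_map -enumT val_enum_ord iota_ltn_sorted.
have fI a : f a \in t by rewrite mem_enum codom_f.
have ltI a : (index (f a) t < p)%N by rewrite -[X in (_ < X)%N](eqP szt) index_mem.
have s_inj : injective (fun a => Ordinal (ltI a)).
  by move=> a b [/(congr1 (nth (f a) t))]; rewrite !nth_index // => /f_inj.
exists (exist _ (Tuple szt) st, perm s_inj); apply/ffunP => a.
by rewrite ffunE /= permE (tnth_nth (f a)) /= nth_index.
Qed.

(** Expanding the determinant row by row gives a sum over all maps from rows to
    columns; the non-injective ones contribute zero, and each injective one is a
    permutation of a unique increasing multi-index. *)
Lemma Cauchy_Binet (A : 'M[R]_(p, n)) (B : 'M[R]_(n, p)) :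
  \det (A *m B) = \sum_(I : multi_index n p)
    \det (\matrix_(a < p, b < p) A a (tnth (val I) b)) *
    \det (\matrix_(a < p, b < p) B (tnth (val I) a) b).
Proof.
pose BF (f : {ffun 'I_p -> 'I_n}) := \matrix_(a < p, b < p) B (f a) b.
transitivity (\sum_(f : {ffun 'I_p -> 'I_n}) (\prod_a A a (f a)) * \det (BF f)).
  transitivity (\sum_(s : 'S_p) \sum_(f : {ffun 'I_p -> 'I_n})
      (-1) ^+ s * \prod_a (A a (f a) * B (f a) (s a))).
    apply: eq_bigr => s _; rewrite -big_distrr.
    rewrite -(bigA_distr_bigA (fun a k => A a k * B k (s a))); congr (_ * _).
    by apply: eq_bigr => a _; rewrite mxE.
  rewrite exchange_big; apply: eq_bigr => f _ /=; rewrite big_distrr.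
  apply: eq_bigr => s _ /=; rewrite big_split mulrCA; congr (_ * (_ * _)).
  by apply: eq_bigr => a _; rewrite mxE.
rewrite (bigID (fun f : {ffun 'I_p -> 'I_n} => injectiveb f)) /=.
rewrite [X in _ + X]big1 => [|f nf]; last first.
  have /injectivePn [a [b ab fab]] := nf.
  have -> : \det (BF f) = 0 by apply: (determinant_alternate ab) => c; rewrite !mxE fab.
  exact: mulr0.
rewrite addr0 (eq_bigl (mem (arrangement @: setT))) => [|f]; last first.
  apply/injectiveP/imsetP => [/arrangement_onto [Is ->]|[Is _ ->]].
    by exists Is; rewrite ?inE.
  move=> a b; rewrite !ffunE => /multi_index_tnth_inj; exact: perm_inj.
rewrite big_imset /=; last by move=> ? ? _ _; apply: arrangement_inj.
rewrite (eq_bigl xpredT) => [|Is]; last by rewrite in_setT.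
rewrite -(pair_bigA _ (fun I s =>
  (\prod_a A a (arrangement (I, s) a)) * \det (BF (arrangement (I, s))))) /=.
apply: eq_bigr => I _; rewrite big_distrl; apply: eq_bigr => s _ /=.
have -> : BF (arrangement (I, s)) =
    row_perm s (\matrix_(a < p, b < p) B (tnth (val I) a) b).
  by apply/matrixP => a b; rewrite !mxE ffunE.
rewrite row_permE det_mulmx det_perm mulrA; congr (_ * _); rewrite mulrC.
by congr (_ * _); apply: eq_bigr => a _; rewrite mxE ffunE.
Qed.

(** If [I] and [L] differ, some row of [I] meets no column of [L] and vanishes. *)
Lemma det_delta_minor (I L : multi_index n p) :
  \det (\matrix_(a < p, b < p) (tnth (val I) a == tnth (val L) b)%:R) = (I == L)%:R :> R.
Proof.
have [->|ne] := eqVneq I L.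
  rewrite -[RHS](det1 R p); congr determinant; apply/matrixP => a b.
  by rewrite !mxE (inj_eq (@multi_index_tnth_inj L)).
have [a nIa] : exists a, tnth (val I) a \notin (val L : seq 'I_n).
  apply/existsP; rewrite -negb_forall; apply: contra ne => /forallP IL.
  exact/eqP/multi_index_eq.
rewrite (expand_det_row _ a) big1 // => b _; rewrite mxE.
by case: eqP => [e|]; [rewrite e mem_tnth in nIa | rewrite mul0r].
Qed.

End CauchyBinet.

Section Pullback.
Variables (R : comNzRingType).

Lemma comp_mpoly_comp n k l (f : {mpoly R[n]}) (phi : n.-tuple {mpoly R[k]})
    (psi : k.-tuple {mpoly R[l]}) (chi : n.-tuple {mpoly R[l]}) :
  (forall i, tnth chi i = tnth phi i \mPo psi) ->
  (f \mPo phi) \mPo psi = f \mPo chi.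
Proof.
move=> chiE; rewrite [f \mPo phi]comp_mpolyEX raddf_sum comp_mpolyEX.
apply: eq_bigr => m _ /=; rewrite comp_mpolyZ !comp_mpolyX rmorph_prod; congr (_ *: _).
by apply: eq_bigr => i _; rewrite rmorphXn chiE.
Qed.

(** The chain rule passes to sums and products, so it needs checking only on
    constants and variables. *)
Lemma mderiv_comp_mpoly n k (f : {mpoly R[n]}) (phi : n.-tuple {mpoly R[k]}) l :
  mderiv l (f \mPo phi) = \sum_(i < n) (mderiv i f \mPo phi) * mderiv l (tnth phi i).
Proof.
pose chain g := mderiv l (g \mPo phi) =
  \sum_(i < n) (mderiv i g \mPo phi) * mderiv l (tnth phi i).
have chainC c : chain c%:MP.
  rewrite /chain comp_mpolyC mderivC big1 // => i _.
  by rewrite mderivC comp_mpoly0 mul0r.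
have chainD g h : chain g -> chain h -> chain (g + h).
  rewrite /chain comp_mpolyD mderivD => -> ->; rewrite -big_split.
  by apply: eq_bigr => i _; rewrite mderivD comp_mpolyD mulrDl.
have chainM g h : chain g -> chain h -> chain (g * h).
  rewrite /chain rmorphM mderivM => -> ->; rewrite mulr_suml mulr_sumr -big_split.
  apply: eq_bigr => i _; rewrite mderivM comp_mpolyD !rmorphM mulrDl /=.
  by congr (_ + _); rewrite ?mulrA // mulrAC.
have chainX i : chain 'X_i.
  rewrite /chain comp_mpolyXU -tnth_nth (bigD1 i) //= mderivX mnmE eqxx.
  rewrite big1 => [|j ne].
    rewrite addr0 -[LHS]mul1r; congr (_ * _).
    have -> : (U_(i) - U_(i) = 0 :> 'X_{1..n})%MM by apply/mnmP => j; rewrite !mnmE subnn.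
    by rewrite scale1r mpolyX0 comp_mpoly1.
  by rewrite mderivX mnmE eq_sym (negbTE ne) scale0r comp_mpoly0 mul0r.
have chain1 : chain 1 by rewrite -mpolyC1.
rewrite -/(chain f); move: f; apply: mpolyind => [|c m g _ _ IH].
  by rewrite -mpolyC0; apply: chainC.
apply: (chainD _ _ _ IH); rewrite -mul_mpolyC.
apply: (chainM _ _ (chainC _)).
rewrite mpolyXE_id; apply: (big_ind chain chain1 chainM) => i _.
by elim: (m i) => [|e IHe]; rewrite ?expr0 // exprS; apply: (chainM).
Qed.

(** The coefficients of the composite pullback are minors of the product of the two
    Jacobian matrices. *)
Lemma pullback_form_comp n p (phi psi chi : n.-tuple {mpoly R[n]})
    (omega : poly_form R n p) :
  (forall i, tnth chi i = tnth phi i \mPo psi) ->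
  pullback_form psi (pullback_form phi omega) = pullback_form chi omega.
Proof.
move=> chiE; apply/ffunP => L; rewrite !ffunE.
under eq_bigr do rewrite ffunE raddf_sum mulr_suml.
rewrite exchange_big; apply: eq_bigr => I _ /=.
under eq_bigr do rewrite rmorphM /= -mulrA.
rewrite -mulr_sumr (comp_mpoly_comp _ chiE); congr (_ * _).
pose A := \matrix_(a < p, k < n) (mderiv k (tnth phi (tnth (val I) a)) \mPo psi).
pose B := \matrix_(k < n, b < p) mderiv (tnth (val L) b) (tnth psi k).
transitivity (\det (A *m B)); last first.
  congr determinant; apply/matrixP => a b; rewrite !mxE chiE mderiv_comp_mpoly.
  by apply: eq_bigr => k _; rewrite !mxE.
rewrite Cauchy_Binet; apply: eq_bigr => I' _; rewrite -det_map_mx; congr (_ * _).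
  by congr determinant; apply/matrixP => a b; rewrite !mxE.
by congr determinant; apply/matrixP => a b; rewrite !mxE.
Qed.

Lemma pullback_form_id n p (phi : n.-tuple {mpoly R[n]}) (omega : poly_form R n p) :
  (forall i, tnth phi i = 'X_i) -> pullback_form phi omega = omega.
Proof.
move=> phiE; apply/ffunP => L; rewrite ffunE.
have -> : \sum_I (omega I \mPo phi) * \det (\matrix_(a < p, b < p)
      mderiv (tnth (val L) b) (tnth phi (tnth (val I) a))) =
    \sum_I omega I * (I == L)%:R.
  apply: eq_bigr => I _; congr (_ * _).
    rewrite -[RHS]comp_mpoly_id; congr (_ \mPo _).
    by apply: eq_from_tnth => i; rewrite phiE tnth_mktuple.
  rewrite -det_delta_minor; congr determinant; apply/matrixP => a b.
  rewrite !mxE phiE mderivX mnmE; case: eqP => [->|_]; last by rewrite scale0r.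
  have -> : (U_(tnth (val L) b) - U_(tnth (val L) b) = 0 :> 'X_{1..n})%MM.
    by apply/mnmP => j; rewrite !mnmE subnn.
  by rewrite mpolyX0 scale1r.
rewrite (bigD1 L) //= eqxx mulr1 big1 ?addr0 // => I /negbTE ->.
by rewrite mulr0.
Qed.

Lemma pullback_form_linear n p (phi : n.-tuple {mpoly R[n]}) (a : R)
    (u v : poly_form R n p) :
  pullback_form phi (a *: u + v) = a *: pullback_form phi u + pullback_form phi v.
Proof.
apply/ffunP => L; rewrite !ffunE scaler_sumr -big_split; apply: eq_bigr => I _.
by rewrite !ffunE comp_mpolyD comp_mpolyZ mulrDl scalerAl.
Qed.

End Pullback.

(** * Polynomial actions on affine space *)

Section PolynomialBCH.
Variables (K : numFieldType) (d e : nat) (br : 'rV[K]_d -> 'rV[K]_d -> 'rV[K]_d).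
Hypothesis br_lie : is_lie_bracket br.

(** The word with the two letters abstracted to booleans, so that its shape no
    longer depends on the point where it is evaluated. *)
Definition dynkin_letters (t : seq ('I_d.+1 * 'I_d.+1)) : seq bool :=
  flatten [seq nseq q.1 true ++ nseq q.2 false | q : 'I_d.+1 * 'I_d.+1 <- t].

Lemma dynkin_wordE (x y : 'rV[K]_d) t :
  dynkin_word x y t = [seq if b then x else y | b : bool <- dynkin_letters t].
Proof.
rewrite /dynkin_word /dynkin_letters map_flatten -map_comp; congr flatten.
by apply: eq_map => q /=; rewrite map_cat !map_nseq.
Qed.

Lemma polynomial_map_bch (f g : 'rV[K]_e -> 'rV[K]_d) :
  polynomial_map f -> polynomial_map g -> polynomial_map (fun x => bch br (f x) (g x)).
Proof.
move=> pf pg.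
have pn (s : seq bool) :
    polynomial_map (fun x => nested_bracket br [seq if b then f x else g x | b : bool <- s]).
  elim: s => [|b [|b' s] IH] /=; first exact: polynomial_map_const.
    by case: b.
  apply: (polynomial_map_bilinear _ _ (f := fun x => if b then f x else g x) _ IH).
  - by move=> *; rewrite (lie_linl br_lie).
  - by move=> *; rewrite (lie_linr br_lie).
  - by case: b.
apply: (@polynomial_map_ext _ _ _ (fun x => \sum_(1 <= k < d.+1)
    \sum_(t : k.-tuple ('I_d.+1 * 'I_d.+1) |
            all (fun q : 'I_d.+1 * 'I_d.+1 => 0 < q.1 + q.2)%N t &&
            (size (dynkin_letters t) <= d)%N)
      ((-1) ^+ k.-1 /
        (k * size (dynkin_letters t) * \prod_(q <- t) (q.1`! * q.2`!))%:R)
      *: nested_bracket br [seq if b then f x else g x | b : bool <- dynkin_letters t])).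
  move=> x; apply: eq_bigr => k _.
  by apply: eq_big => [t|t _]; rewrite !dynkin_wordE size_map.
apply: polynomial_map_sum => k _; apply: polynomial_map_sum => t _.
by apply: polynomial_map_scale_const.
Qed.

End PolynomialBCH.

Section PolymapLemmas.
Variables (K : numFieldType) (d n : nat).

Lemma mpoly_eval_inj (P Q : {mpoly K[n]}) :
  (forall w : 'rV[K]_n, P.@[fun i => w 0 i] = Q.@[fun i => w 0 i]) -> P = Q.
Proof.
move=> PQ; apply/eqP; rewrite -subr_eq0; apply/eqP/mpoly_nat_eq0 => v.
have := PQ (\row_i (v i)%:R); rewrite mevalB => e.
apply/eqP; rewrite subr_eq0; apply/eqP; move: e.
by rewrite -!(meval_eq _ (v1 := fun i => (\row_i (v i)%:R) 0 i) (v2 := fun i => (v i)%:R)) // => i;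
  rewrite mxE.
Qed.

Lemma polynomial_map_nat_eq0 (f : 'rV[K]_d -> K) :
  polynomial_map (f : _ -> K^o) -> (forall v : 'I_d -> nat, f (\row_i (v i)%:R) = 0) ->
  forall x, f x = 0.
Proof.
move=> /polynomial_map_scalarP [P fE] f0 x; rewrite fE.
rewrite (_ : P = 0) ?meval0 //; apply: mpoly_nat_eq0 => v.
by rewrite -[RHS](f0 v) fE; apply: meval_eq => i; rewrite mxE.
Qed.

Lemma polynomial_map_row_mx (e a b : nat) (f : 'rV[K]_e -> 'rV[K]_a)
    (g : 'rV[K]_e -> 'rV[K]_b) :
  polynomial_map f -> polynomial_map g -> polynomial_map (fun x => row_mx (f x) (g x)).
Proof.
move=> pf pg; apply: polynomial_map_row => i; case: (splitP i) => j ij.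
  apply: polynomial_map_ext (polynomial_map_entry j pf) => x.
  by rewrite (_ : i = lshift b j) ?row_mxEl //; apply: val_inj.
apply: polynomial_map_ext (polynomial_map_entry j pg) => x.
by rewrite (_ : i = rshift a j) ?row_mxEr //; apply: val_inj.
Qed.

Lemma polynomial_map_polymap (e a b : nat) (P : b.-tuple {mpoly K[a]})
    (f : 'rV[K]_e -> 'rV[K]_a) :
  polynomial_map f -> polynomial_map (fun x => polymap P (f x)).
Proof.
move=> pf; apply: polynomial_map_row => i.
apply: (polynomial_map_ext (f := fun x => (tnth P i).@[fun k => f x 0 k] : K^o)).
  by move=> x; rewrite mxE.
by apply: polynomial_map_meval_comp => k; apply: polynomial_map_entry.
Qed.

Lemma polymap_specialize (F : n.-tuple {mpoly K[d + n]}) z w :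
  polymap (specialize F z) w = polymap F (row_mx z w).
Proof.
apply/rowP => j; rewrite !mxE tnth_mktuple comp_mpoly_meval; apply: meval_eq => k.
rewrite tnth_mktuple; case: (splitP k) => l kl.
  by rewrite mevalC (_ : k = lshift n l) ?row_mxEl //; apply: val_inj.
by rewrite mevalXU (_ : k = rshift d l) ?row_mxEr //; apply: val_inj.
Qed.

Lemma polynomial_map_specialize (F : n.-tuple {mpoly K[d + n]}) j :
  polynomial_map (fun z => tnth (specialize F z) j).
Proof.
apply: (@polynomial_map_ext _ _ _ (fun z : 'rV[K]_d => tnth F j \mPo
     [tuple match fintype.split k with
            | inl i => (z 0 i)%:MP
            | inr l => 'X_l
            end | k < d + n])) => [z|]; first by rewrite tnth_mktuple.
apply: polynomial_map_comp_mpoly => k.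
case E: (fintype.split k) => [i|l].
  apply: (@polynomial_map_ext _ _ _ (fun z : 'rV[K]_d => (z 0 i) *: (1 : {mpoly K[n]}))).
    by move=> z; rewrite tnth_mktuple E -mul_mpolyC mulr1.
  apply: (polynomial_map_scale (a := fun z : 'rV[K]_d => z 0 i : K^o)).
    exact: polynomial_map_coord.
  exact: polynomial_map_const.
apply: (@polynomial_map_ext _ _ _ (fun=> ('X_l : {mpoly K[n]}))) => [z|].
  by rewrite tnth_mktuple E.
exact: polynomial_map_const.
Qed.

End PolymapLemmas.

Definition is_polynomial_action (K : numFieldType) (d n : nat)
    (H : sc_nilpotent_group K d) (F : n.-tuple {mpoly K[d + n]}) : Prop :=
  (forall w, polymap F (row_mx (log (1%g : H)) w) = w) /\
  forall (x y : H) w, polymap F (row_mx (log (x * y)%g) w) =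
    polymap F (row_mx (log x) (polymap F (row_mx (log y) w))).

(** Both sides of the action law are polynomial in the group variables, so the law
    may be tested on integral points, where it is inherited from a real form. *)
Lemma polynomial_action_of_nat (K : numFieldType) (d n : nat)
    (H : sc_nilpotent_group K d) (F : n.-tuple {mpoly K[d + n]}) :
  (forall w, polymap F (row_mx 0 w) = w) ->
  (forall (s t : 'I_d -> nat) w, let S := \row_i (s i)%:R in let T := \row_i (t i)%:R in
    polymap F (row_mx (bch (bracket H) S T) w) =
    polymap F (row_mx S (polymap F (row_mx T w)))) ->
  is_polynomial_action H F.
Proof.
move=> F0 FM; split=> [w|x y w]; first by rewrite -(exp0 H) expK F0.
rewrite -[x]logK -[y]logK expM !expK; set a := log x; set b := log y.
apply/rowP => j; apply/eqP; rewrite -subr_eq0; apply/eqP.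
pose f (u : 'rV[K]_(d + d)) : K :=
  polymap F (row_mx (bch (bracket H) (lsubmx u) (rsubmx u)) w) 0 j -
  polymap F (row_mx (lsubmx u) (polymap F (row_mx (rsubmx u) w))) 0 j.
suff: f (row_mx a b) = 0 by rewrite /f row_mxKl row_mxKr.
have pl : polynomial_map (fun u : 'rV[K]_(d + d) => lsubmx u).
  apply: polynomial_map_row => i.
  apply: (@polynomial_map_ext _ _ _ (fun u : 'rV[K]_(d + d) => u 0 (lshift d i) : K^o)) => [u|].
    by rewrite mxE.
  exact: polynomial_map_coord.
have pr : polynomial_map (fun u : 'rV[K]_(d + d) => rsubmx u).
  apply: polynomial_map_row => i.
  apply: (@polynomial_map_ext _ _ _ (fun u : 'rV[K]_(d + d) => u 0 (rshift d i) : K^o)) => [u|].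
    by rewrite mxE.
  exact: polynomial_map_coord.
have pw : polynomial_map (fun u : 'rV[K]_(d + d) => w) by apply: polynomial_map_const.
apply: polynomial_map_nat_eq0 => [|v].
  apply: (@polynomial_map_ext _ _ _ (fun u : 'rV_(d + d) =>
    (polymap F (row_mx (bch (bracket H) (lsubmx u) (rsubmx u)) w) 0 j : K^o) +
    (-1 : K) *: (polymap F (row_mx (lsubmx u) (polymap F (row_mx (rsubmx u) w))) 0 j : K^o))).
    by move=> u; rewrite scaleN1r.
  apply: polynomial_map_add; last apply: polynomial_map_scale_const.
    apply: polynomial_map_entry; apply: polynomial_map_polymap.
    by apply: polynomial_map_row_mx => //; apply: polynomial_map_bch => //; apply: bracket_lie.
  apply: polynomial_map_entry; apply: polynomial_map_polymap.
  apply: polynomial_map_row_mx => //; apply: polynomial_map_polymap.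
  exact: polynomial_map_row_mx.
have -> : \row_i (v i)%:R = row_mx (\row_i (v (lshift d i))%:R)
    (\row_i (v (rshift d i))%:R) :> 'rV[K]_(d + d).
  apply/rowP => i; rewrite mxE; case: (splitP i) => k ik.
    by rewrite (_ : i = lshift d k) ?row_mxEl ?mxE //; apply: val_inj.
  by rewrite (_ : i = rshift d k) ?row_mxEr ?mxE //; apply: val_inj.
by rewrite /f row_mxKl row_mxKr FM subrr.
Qed.

Section InducedActions.
Variables (K : numFieldType) (d n p : nat) (H : sc_nilpotent_group K d).
Variable F : n.-tuple {mpoly K[d + n]}.
Hypothesis F_action : is_polynomial_action H F.

Lemma rhoC1 i : tnth (rhoC F (1%g : H)) i = 'X_i.
Proof.
apply: mpoly_eval_inj => w; rewrite mevalXU -[in RHS](F_action.1 w).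
by rewrite -polymap_specialize mxE.
Qed.

Lemma rhoCM (x y : H) i : tnth (rhoC F (x * y)%g) i = tnth (rhoC F x) i \mPo rhoC F y.
Proof.
apply: mpoly_eval_inj => w; rewrite comp_mpoly_meval.
have := congr1 (fun v : 'rV_n => v 0 i) (F_action.2 x y w).
rewrite -!polymap_specialize mxE => ->; rewrite mxE; apply: meval_eq => j.
by rewrite mxE.
Qed.

Lemma polynomial_map_rhoCV i : polynomial_map (fun z => tnth (rhoC F (exp H z)^-1%g) i).
Proof.
apply: (polynomial_map_ext (f := fun z => tnth (specialize F (- z)) i)).
  by move=> z; rewrite /rhoC logV expK.
exact: (polynomial_map_comp (polynomial_map_specialize F i) (polynomial_map_opp K d)).
Qed.

Lemma fun_action_linear : linear_action (fun_action F (H := H)).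
Proof.
split=> [x a u v|v|x y v]; rewrite /fun_action /pullback_fun.
- by rewrite comp_mpolyD comp_mpolyZ.
- rewrite invg1 -[RHS]comp_mpoly_id; congr (_ \mPo _).
  by apply: eq_from_tnth => i; rewrite rhoC1 tnth_mktuple.
- rewrite invgM; apply/esym/comp_mpoly_comp => i; exact: rhoCM.
Qed.

Lemma fun_action_polynomial v : polynomial_map (fun z => fun_action F (exp H z) v).
Proof. by apply: polynomial_map_comp_mpoly => i; apply: polynomial_map_rhoCV. Qed.

Lemma form_action_linear : linear_action (form_action (p := p) F (H := H)).
Proof.
split=> [x a u v|v|x y v]; rewrite /form_action.
- exact: pullback_form_linear.
- by apply: pullback_form_id => i; rewrite invg1 rhoC1.
- by rewrite invgM; apply/esym/pullback_form_comp => i; apply: rhoCM.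
Qed.

(** The pullback is built from the coefficients of [v], the components of the
    action and their derivatives by substitution, products and sums. *)
Lemma form_action_polynomial v :
  polynomial_map (fun z => form_action (p := p) F (exp H z) v).
Proof.
apply: polynomial_map_ffun => L.
apply: (@polynomial_map_ext _ _ _ (fun z => \sum_(I : multi_index n p)
     (v I \mPo rhoC F (exp H z)^-1%g) *
     \det (\matrix_(a < p, b < p) mderiv (tnth (val L) b)
             (tnth (rhoC F (exp H z)^-1%g) (tnth (val I) a))))).
  by move=> z; rewrite ffunE.
apply: polynomial_map_sum => I _; apply: polynomial_map_mul.
  by apply: polynomial_map_comp_mpoly => i; apply: polynomial_map_rhoCV.
apply: polynomial_map_det => a b.
apply: (@polynomial_map_ext _ _ _ (fun z => mderiv (tnth (val L) b)
             (tnth (rhoC F (exp H z)^-1%g) (tnth (val I) a)))).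
  by move=> z; rewrite mxE.
apply: (polynomial_map_linear _ (polynomial_map_rhoCV _)) => c u w.
by rewrite mderivD mderivZ.
Qed.

Lemma bounded_mpoly_span m : exists r (u : 'I_r -> {mpoly K[n]}),
  forall f, (msize f <= m)%N -> span_of u f.
Proof.
pose u (k : 'X_{1..n < m}) : {mpoly K[n]} := 'X_[k].
exists #|{: 'X_{1..n < m}}|, (fun i => u (enum_val i)) => f fm.
rewrite (mpolywE fm); exact: (span_of_fin u (fun k => f@_k)).
Qed.

Lemma bounded_form_span m : exists r (u : 'I_r -> poly_form K n p),
  forall w : poly_form K n p, (forall I, (msize (w I) <= m)%N) -> span_of u w.
Proof.
pose u (s : multi_index n p * 'X_{1..n < m}) : poly_form K n p :=
  [ffun I => if I == s.1 then 'X_[s.2] else 0].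
exists #|{: multi_index n p * 'X_{1..n < m}}|, (fun i => u (enum_val i)) => w wm.
have -> : w = \sum_(s : multi_index n p * 'X_{1..n < m}) (w s.1)@_(s.2) *: u s.
  apply/ffunP => I; rewrite sum_ffunE.
  rewrite -(pair_bigA _ (fun J (k : 'X_{1..n < m}) => ((w J)@_k *: u (J, k)) I)) /= (bigD1 I) //=.
  rewrite [X in _ + X]big1 => [|J /negbTE ne]; last first.
    by apply: big1 => k _; rewrite !ffunE eq_sym ne scaler0.
  rewrite addr0 {1}(mpolywE (wm I)); apply: eq_bigr => k _.
  by rewrite !ffunE eqxx.
exact: span_of_fin.
Qed.

Lemma directed_orbit_span (V : lmodType K) (act : H -> V -> V) (D : nat -> V -> Prop) :
  linear_action act -> (forall m1 m2, (m1 <= m2)%N -> forall v, D m1 v -> D m2 v) ->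
  (forall v, exists m, D m v) -> directed_union (fun m => orbit_span act (D m)).
Proof.
move=> lin_act D_mono D_all; split=> [m1 m2 le12|v].
  apply: lspan_sub; first exact: subspace_lspan.
  move=> _ [x [u [Du ->]]]; apply: lspan_gen; exists x, u.
  by split=> //; apply: D_mono Du.
by have [m Dv] := D_all v; exists m; apply: orbit_span_gen.
Qed.

Lemma W_fun_directed : directed_union (W_fun H F).
Proof.
apply: directed_orbit_span; first exact: fun_action_linear.
  by move=> m1 m2 le12 f /leq_trans; apply; rewrite ltnS.
by move=> f; exists (msize f); apply: leqnSn.
Qed.

Lemma W_form_directed : directed_union (W_form (p := p) H F).
Proof.
apply: directed_orbit_span; first exact: form_action_linear.
  by move=> m1 m2 le12 w wm I; apply: leq_trans (wm I) _; rewrite ltnS.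
move=> w; exists (\max_I msize (w I))%N => I; apply: leqW.
exact: (leq_bigmax I).
Qed.

Lemma W_fun_finite_dim m : finite_dim (W_fun H F m).
Proof.
have [r [u uP]] := bounded_mpoly_span m.+1.
exact: (finite_dim_orbit_span fun_action_linear fun_action_polynomial uP).
Qed.

Lemma W_form_finite_dim m : finite_dim (W_form (p := p) H F m).
Proof.
have [r [u uP]] := bounded_form_span m.+1.
exact: (finite_dim_orbit_span form_action_linear form_action_polynomial uP).
Qed.

End InducedActions.

(** * The deck action *)

(** At real points the action law is associativity in the real group. *)
Lemma complexified_deck_action (R : realType) (d n : nat) (G : sc_nilpotent_group R d)
    (GC : sc_nilpotent_group R[i] d) (Phi : G -> 'rV[R[i]]_n) (Psi : 'rV[R[i]]_n -> G)
    (F : n.-tuple {mpoly R[i][d + n]}) :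
  is_complexification G GC -> cancel Phi Psi -> cancel Psi Phi ->
  represents_deck Phi Psi F -> is_polynomial_action GC F.
Proof.
move=> cG PhiK PsiK hF; apply: polynomial_action_of_nat => [w|s t w].
  have := hF 0 w; rewrite /deck exp0 mul1g PsiK => {2}->; congr (polymap _ (row_mx _ _)).
  by rewrite /to_C map_mx0.
have toCE (r : 'I_d -> nat) : \row_i (r i)%:R = to_C (\row_i (r i)%:R) :> 'rV[R[i]]_d.
  by apply/rowP => i; rewrite !mxE rmorph_nat.
have bchE S T : bch (bracket GC) (to_C S) (to_C T) = to_C (bch (bracket G) S T).
  exact: (bch_map cG).
by move=> S T; rewrite /S /T !toCE bchE -!hF -expM /deck PhiK mulgA.
Qed.

(** A real group element acts as the complex one with the same coordinates. *)
Lemma real_points_unipotent (R : realType) (d n p : nat) (G : sc_nilpotent_group R d)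
    (GC : sc_nilpotent_group R[i] d) (Phi : G -> 'rV[R[i]]_n) (Psi : 'rV[R[i]]_n -> G)
    (F : n.-tuple {mpoly R[i][d + n]}) :
  represents_deck Phi Psi F ->
  (forall x m, unipotent_on (fun_action F (x : GC)) (W_fun GC F m)) ->
  (forall x m, unipotent_on (form_action (p := p) F (x : GC)) (W_form GC F m)) ->
  forall g : G, exists phi : n.-tuple {mpoly R[i][n]},
     (forall w, polymap phi w = deck Phi Psi (g^-1)%g w) /\
     forall m, unipotent_on (pullback_fun phi) (W_fun GC F m) /\
       unipotent_on (pullback_form (p := p) phi) (W_form GC F m).
Proof.
move=> hF uW uWp g; pose x := exp GC (to_C (log g)).
exists (rhoC F x^-1%g); split=> [w|m]; last first.
  by split; [exact: (uW x)|exact: (uWp x)].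
rewrite polymap_specialize logV expK -[(g^-1)%g]logK hF logV.
by rewrite /to_C map_mxN.
Qed.

Theorem theorem5p4 (R : realType) (n p : nat)
    (G : sc_nilpotent_group R (2 * n))
    (J : 'M[R]_(2 * n)) (hJ : left_invariant_complex_structure G J)
    (Gamma : set G) (hGamma : is_lattice Gamma)
    (GC : sc_nilpotent_group R[i] (2 * n)) (hGC : is_complexification G GC)
    (Phi : G -> 'rV[R[i]]_n) (Psi : 'rV[R[i]]_n -> G)
    (hPhi : polynomial_biholomorphism J Phi Psi)
    (F : n.-tuple {mpoly R[i][2 * n + n]}) (hF : represents_deck Phi Psi F) :
  let reg := @regular_function R[i] (2 * n) GC in
  let act := fun_action (H := GC) F in
  let actp := form_action (p := p) (H := GC) F in
  let W := W_fun GC F in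
  let Wp := W_form (p := p) GC F in
  (locally_finite act /\ locally_unipotent act /\ rational_module reg act /\
   directed_union W /\
   forall m, finite_dim (W m) /\ stable act (W m) /\
     unipotent_rep reg act (W m) /\ has_trivial_flag act (W m)) /\
  (locally_finite actp /\ locally_unipotent actp /\ rational_module reg actp /\
   directed_union Wp /\
   forall m, finite_dim (Wp m) /\ stable actp (Wp m) /\
     unipotent_rep reg actp (Wp m) /\ has_trivial_flag actp (Wp m)) /\
  (forall g : G, exists phi : n.-tuple {mpoly R[i][n]},
     (forall w, polymap phi w = deck Phi Psi (g^-1)%g w) /\
     forall m, unipotent_on (pullback_fun phi) (W m) /\
       unipotent_on (pullback_form (p := p) phi) (Wp m)) /\
  (forall g : G, Gamma g -> exists phi : n.-tuple {mpoly R[i][n]},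
     (forall w, polymap phi w = deck Phi Psi (g^-1)%g w) /\
     forall m, unipotent_on (pullback_fun phi) (W m) /\
       unipotent_on (pullback_form (p := p) phi) (Wp m)).
Proof.
move=> reg act actp W Wp.
have [PhiK [PsiK _]] := hPhi.
have hact := complexified_deck_action hGC PhiK PsiK hF.
have lin := fun_action_linear hact; have pol := fun_action_polynomial GC F.
have linp := form_action_linear p hact; have polp := @form_action_polynomial _ _ _ p GC F.
have sub m : [/\ finite_dim (W m), stable act (W m),
    unipotent_rep reg act (W m) & has_trivial_flag act (W m)].
  have fW := W_fun_finite_dim hact m; have sW := stable_orbit_span lin.
  by have [uW flW] := polynomial_action_submodule lin pol fW (sW _); split=> //; apply: sW.
have subp m : [/\ finite_dim (Wp m), stable actp (Wp m),
    unipotent_rep reg actp (Wp m) & has_trivial_flag actp (Wp m)].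
  have fW := W_form_finite_dim p hact m; have sW := stable_orbit_span linp.
  by have [uW flW] := polynomial_action_submodule linp polp fW (sW _); split=> //; apply: sW.
have uW x m : unipotent_on (act x) (W m) by have [_ _ [_ u] _] := sub m.
have uWp x m : unipotent_on (actp x) (Wp m) by have [_ _ [_ u] _] := subp m.
have real := real_points_unipotent hF uW uWp.
split; last split; last by split=> [|g _]; apply: real.
- split; first exact: polynomial_action_locally_finite.
  split; first exact: polynomial_action_locally_unipotent.
  split; first exact: polynomial_action_rational.
  split; first exact: W_fun_directed.
  by move=> m; have [] := sub m.
- split; first exact: polynomial_action_locally_finite.
  split; first exact: polynomial_action_locally_unipotent.
  split; first exact: polynomial_action_rational.
  split; first exact: W_form_directed.
  by move=> m; have [] := subp m.
Qed.
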